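(* Let $\mathbb{F}$ be a field, $\Gamma$ an arbitrary digraph, $L(\Gamma)=L_{\mathbb{F}}(\Gamma)$ its Leavitt path algebra, and $P$ a finitely generated projective (right) $L(\Gamma)$-module. The following are equivalent: (i) the endomorphism algebra $\mathrm{End}^{L(\Gamma)}(P)$ is finite dimensional over $\mathbb{F}$; (ii) $P\cong\bigoplus_{i=1}^n v_iL(\Gamma)$ where each $v_i$ is a sink or a leak; (iii) $\mathrm{End}^{L(\Gamma)}(P)$ is isomorphic to a finite direct sum of matrix algebras over $\mathbb{F}$.
   Context: A digraph $\Gamma=(V,E,s,t)$ consists of arbitrary (possibly infinite) sets $V$ of vertices and $E$ of arrows and functions $s,t:E\to V$ (source, target). The Leavitt path algebra $L(\Gamma)=L_{\mathbb{F}}(\Gamma)$ is the (not necessarily unital) $\mathbb{F}$-algebra generated by $V\sqcup E\sqcup\{e^*: e\in E\}$ subject to: $uv=\delta_{u,v}u$ for $u,v\in V$; $s(e)e=e=e\,t(e)$ and $t(e)e^*=e^*=e^*s(e)$ for $e\in E$; (CK1) $e^*f=\delta_{e,f}t(e)$; (CK2) $v=\sum_{s(e)=v}ee^*$ for every $v$ with $0<|s^{-1}(v)|<\infty$. Modules are unital right modules ($M=ML(\Gamma)$). A path of length $n>0$ is a sequence of arrows $e_1\cdots e_n$ with $t(e_i)=s(e_{i+1})$, with source $s(e_1)$ and target $t(e_n)$; a path of length $0$ is a vertex $v$, with $s(v)=t(v)=v$. A sink is a vertex $v$ with $s^{-1}(v)=\emptyset$. A leak is a vertex $v$ such that for every $n\in\mathbb{N}$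 (including $0$) there is exactly one path $p_n$ of length $n$ with $s(p_n)=v$, and $t(p_m)\neq t(p_n)$ for all $m\neq n$. *)

(* Defs.v *)
From HB Require Import structures.
From mathcomp Require Import all_boot all_algebra.
From mathcomp Require Import boolp functions.

Set Implicit Arguments.
Unset Strict Implicit.
Unset Printing Implicit Defensive.

Import GRing.Theory.
Local Open Scope ring_scope.
Local Open Scope quotient_scope.

HB.mixin Record Lmodule_isNuAlgebra (F : fieldType) A of GRing.Lmodule F A := {
  numul : A -> A -> A;
  numulA : associative numul;
  numulDl : left_distributive numul +%R;
  numulDr : right_distributive numul +%R;
  numulZl : forall (c : F) (x y : A), numul (c *: x) y = c *: numul x y;
  numulZr : forall (c : F) (x y : A), numul x (c *: y) = c *: numul x y
}.

#[short(type="nuAlgType")]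
HB.structure Definition NuAlgebra (F : fieldType) :=
  {A of Lmodule_isNuAlgebra F A & GRing.Lmodule F A}.

Notation "x ** y" := (numul x y) (at level 40, left associativity) : ring_scope.

(* [ract_unital] says that M = MA, where MA is the set of all finite sums of   *)
(* products x *> a; it does not presuppose an identity element in A.          *)
HB.mixin Record Lmodule_isUnitalRModule (F : fieldType) (A : nuAlgType F) M
    of GRing.Lmodule F M := {
  ract : M -> A -> M;
  ractA : forall (x : M) (a b : A), ract (ract x a) b = ract x (a ** b);
  ractDl : forall (x y : M) (a : A), ract (x + y) a = ract x a + ract y a;
  ractDr : forall (x : M) (a b : A), ract x (a + b) = ract x a + ract x b;
  ractZl : forall (c : F) (x : M) (a : A), ract (c *: x) a = c *: ract x a;
  ractZr : forall (c : F) (x : M) (a : A), ract x (c *: a) = c *: ract x a;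
  ract_unital : forall x : M,
    exists s : seq (M * A), x = \sum_(p <- s) ract p.1 p.2
}.

#[short(type="urmodType")]
HB.structure Definition UnitalRModule (F : fieldType) (A : nuAlgType F) :=
  {M of Lmodule_isUnitalRModule F A M & GRing.Lmodule F M}.

Notation "x *> a" := (ract x a) (at level 40, left associativity) : ring_scope.

Section RModule.
Variables (F : fieldType) (A : nuAlgType F).
Implicit Types M N P : urmodType A.

Definition rmod_hom M N (f : M -> N) : Prop :=
  linear f /\ forall (x : M) (a : A), f (x *> a) = f x *> a.

Definition rmod_iso M N : Prop :=
  exists f : M -> N, rmod_hom f /\ bijective f.

(* Since x belongs to xA in the unital modules over an algebra with local      *)
(* units, the sum of the x i *> A is the submodule generated by the x i.      *)
Definition rmod_fg P : Prop :=
  exists (n : nat) (x : 'I_n -> P),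
    forall y : P, exists a : 'I_n -> A, y = \sum_(i < n) x i *> a i.

Definition rmod_projective P : Prop :=
  forall (M N : urmodType A) (g : M -> N) (f : P -> N),
    rmod_hom g -> (forall y : N, exists x : M, g x = y) -> rmod_hom f ->
    exists h : P -> M, rmod_hom h /\ forall x : P, g (h x) = f x.

End RModule.

Section DirectSum.
Variables (F : fieldType) (A : nuAlgType F) (n : nat) (M : 'I_n -> urmodType A).

Definition rmod_dsum : Type := forall i : 'I_n, M i.

HB.instance Definition _ := Choice.copy rmod_dsum (forall i : 'I_n, M i).

Implicit Types f g h : rmod_dsum.

Definition dsum_zero : rmod_dsum := fun i => 0.
Definition dsum_opp f : rmod_dsum := fun i => - f i.
Definition dsum_add f g : rmod_dsum := fun i => f i + g i.
Definition dsum_scale (c : F) f : rmod_dsum := fun i => c *: f i.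
Definition dsum_act f (a : A) : rmod_dsum := fun i => f i *> a.

Fact dsum_addA : associative dsum_add.
Proof. by move=> f g h; apply: functional_extensionality_dep => i; rewrite /dsum_add addrA. Qed.
Fact dsum_addC : commutative dsum_add.
Proof. by move=> f g; apply: functional_extensionality_dep => i; rewrite /dsum_add addrC. Qed.
Fact dsum_add0 : left_id dsum_zero dsum_add.
Proof. by move=> f; apply: functional_extensionality_dep => i; rewrite /dsum_add add0r. Qed.
Fact dsum_addN : left_inverse dsum_zero dsum_opp dsum_add.
Proof. by move=> f; apply: functional_extensionality_dep => i; rewrite /dsum_add addNr. Qed.

HB.instance Definition _ := GRing.isZmodule.Build rmod_dsum
  dsum_addA dsum_addC dsum_add0 dsum_addN.

Fact dsum_scaleA a b f : dsum_scale a (dsum_scale b f) = dsum_scale (a * b) f.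
Proof. by apply: functional_extensionality_dep => i; rewrite /dsum_scale scalerA. Qed.
Fact dsum_scale1 : left_id 1 dsum_scale.
Proof. by move=> f; apply: functional_extensionality_dep => i; rewrite /dsum_scale scale1r. Qed.
Fact dsum_scaleDr : right_distributive dsum_scale +%R.
Proof. by move=> c f g; apply: functional_extensionality_dep => i; apply: scalerDr. Qed.
Fact dsum_scaleDl f : {morph dsum_scale^~ f : a b / a + b}.
Proof. by move=> a b; apply: functional_extensionality_dep => i; apply: scalerDl. Qed.

HB.instance Definition _ := GRing.Zmodule_isLmodule.Build F rmod_dsum
  dsum_scaleA dsum_scale1 dsum_scaleDr dsum_scaleDl.

Lemma dsum_sumE (I : Type) (r : seq I) (G : I -> rmod_dsum) i :
  (\sum_(j <- r) G j) i = \sum_(j <- r) G j i.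
Proof.
by elim: r => [|j r IH]; rewrite ?big_nil // !big_cons -IH.
Qed.

Fact dsum_actA f a b : dsum_act (dsum_act f a) b = dsum_act f (a ** b).
Proof. by apply: functional_extensionality_dep => i; apply: ractA. Qed.
Fact dsum_actDl f g a : dsum_act (f + g) a = dsum_act f a + dsum_act g a.
Proof. by apply: functional_extensionality_dep => i; apply: ractDl. Qed.
Fact dsum_actDr f a b : dsum_act f (a + b) = dsum_act f a + dsum_act f b.
Proof. by apply: functional_extensionality_dep => i; apply: ractDr. Qed.
Fact dsum_actZl c f a : dsum_act (c *: f) a = c *: dsum_act f a.
Proof. by apply: functional_extensionality_dep => i; apply: ractZl. Qed.
Fact dsum_actZr c f a : dsum_act f (c *: a) = c *: dsum_act f a.
Proof. by apply: functional_extensionality_dep => i; apply: ractZr. Qed.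

Definition dsum_inj (i : 'I_n) (x : M i) : rmod_dsum := fun j =>
  if @eqP _ i j is ReflectT e then ecast k (M k) e x else 0.

Lemma dsum_injE i x : dsum_inj x i = x.
Proof. by rewrite /dsum_inj; case: eqP => // e; rewrite eq_axiomK. Qed.

Lemma dsum_inj_neq i j (x : M i) : i != j -> dsum_inj x j = 0.
Proof. by rewrite /dsum_inj; case: eqP. Qed.

Lemma dsum_injD i : {morph @dsum_inj i : x y / x + y}.
Proof.
move=> x y; apply: functional_extensionality_dep => j.
case: (eqVneq i j) => [<-|ne].
  by rewrite dsum_injE; congr (_ + _); rewrite dsum_injE.
rewrite dsum_inj_neq // -[LHS]addr0.
by congr (_ + _); rewrite dsum_inj_neq.
Qed.

Lemma dsum_inj_act i (x : M i) a : dsum_inj (x *> a) = dsum_act (dsum_inj x) a.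
Proof.
apply: functional_extensionality_dep => j; rewrite /dsum_act.
case: (eqVneq i j) => [<-|ne]; first by rewrite !dsum_injE.
by rewrite !dsum_inj_neq // -[0 in RHS](scale0r 0) ractZl scale0r.
Qed.

Lemma dsum_decomp f : f = \sum_(i < n) dsum_inj (f i).
Proof.
apply: functional_extensionality_dep => i; rewrite dsum_sumE.
rewrite (bigD1 i) //= dsum_injE big1 ?addr0 // => j ji.
by rewrite dsum_inj_neq.
Qed.

Fact dsum_unital f :
  exists s : seq (rmod_dsum * A), f = \sum_(p <- s) dsum_act p.1 p.2.
Proof.
rewrite (dsum_decomp f).
elim: (index_enum _) => [|i r [s IH]]; first by exists [::]; rewrite !big_nil.
have [t ft] := ract_unital (f i).
exists ([seq (dsum_inj p.1, p.2) | p <- t] ++ s).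
rewrite big_cons big_cat big_map IH /= {1}ft; congr (_ + _).
elim: t {ft} => [|p t IHt].
  rewrite !big_nil; apply: (@addrI _ (dsum_inj (0 : M i))).
  by rewrite -dsum_injD !addr0.
by rewrite !big_cons dsum_injD IHt dsum_inj_act.
Qed.

HB.instance Definition _ := Lmodule_isUnitalRModule.Build F A rmod_dsum
  dsum_actA dsum_actDl dsum_actDr dsum_actZl dsum_actZr dsum_unital.

End DirectSum.

Section EndAlgebra.
Variables (F : fieldType) (A : nuAlgType F) (P : urmodType A).

Definition rmod_hom_pred : {pred P -> P} := fun f => `[< rmod_hom f >].

Fact rmod_hom_submod : submod_closed rmod_hom_pred.
Proof.
split=> [|c f g /asboolP[lf af] /asboolP[lg ag]]; apply/asboolP; split.
- by move=> c x y; change (0 = c *: 0 + 0 :> P); rewrite scaler0 addr0.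
- move=> x a; change (0 = 0 *> a :> P).
  by rewrite -[0 in RHS](scale0r 0) ractZl scale0r.
- move=> d x y.
  change (c *: f (d *: x + y) + g (d *: x + y)
          = d *: (c *: f x + g x) + (c *: f y + g y)).
  rewrite lf lg !scalerDr !scalerA mulrC -!addrA; congr (_ + _).
  by rewrite addrCA.
- move=> x a; change (c *: f (x *> a) + g (x *> a) = (c *: f x + g x) *> a).
  by rewrite af ag ractDl ractZl.
Qed.

HB.instance Definition _ :=
  GRing.isSubmodClosed.Build F (P -> P) rmod_hom_pred rmod_hom_submod.

Record rmod_end : Type :=
  RModEnd { end_fun :> P -> P; _ : end_fun \in rmod_hom_pred }.

HB.instance Definition _ := [isSub for end_fun].
HB.instance Definition _ := [Choice of rmod_end by <:].
HB.instance Definition _ := [SubChoice_isSubLmodule of rmod_end by <:].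

Lemma rmod_endP (f : rmod_end) : rmod_hom f.
Proof. by case: f => f fP; apply/asboolP. Qed.

Lemma rmod_end_ext (f g : rmod_end) : f =1 g -> f = g.
Proof. by move=> fg; apply: val_inj; apply: functional_extensionality_dep. Qed.

Fact rmod_end1_subproof : idfun \in rmod_hom_pred.
Proof. by apply/asboolP. Qed.

Fact rmod_endM_subproof (f g : rmod_end) : (f \o g : P -> P) \in rmod_hom_pred.
Proof.
have [[lf af] [lg ag]] := (rmod_endP f, rmod_endP g).
by apply/asboolP; split=> [c x y|x a] /=; rewrite ?lg ?lf ?ag ?af.
Qed.

Definition rmod_end1 : rmod_end := RModEnd rmod_end1_subproof.
Definition rmod_endM (f g : rmod_end) : rmod_end :=
  RModEnd (rmod_endM_subproof f g).

Fact rmod_endMA : associative rmod_endM.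
Proof. by move=> f g h; apply: rmod_end_ext. Qed.
Fact rmod_end1M : left_id rmod_end1 rmod_endM.
Proof. by move=> f; apply: rmod_end_ext. Qed.
Fact rmod_endM1 : right_id rmod_end1 rmod_endM.
Proof. by move=> f; apply: rmod_end_ext. Qed.
Fact rmod_endMDl : left_distributive rmod_endM +%R.
Proof. by move=> f g h; apply: rmod_end_ext. Qed.
Fact rmod_endMDr : right_distributive rmod_endM +%R.
Proof.
move=> f g h; apply: rmod_end_ext => x; have [lf _] := rmod_endP f.
by have := lf 1 (g x) (h x); rewrite !scale1r.
Qed.

(* The trivial module has the zero ring as endomorphism ring, hence pzRing.   *)
HB.instance Definition _ := GRing.Zmodule_isPzRing.Build rmod_end
  rmod_endMA rmod_end1M rmod_endM1 rmod_endMDl rmod_endMDr.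

Definition end_finite_dimensional : Prop :=
  exists d : nat, inhabited (Vector.axiom d rmod_end).

(* The direct sum of matrix algebras is their product type with componentwise *)
(* operations, so that a map into it is an algebra morphism exactly when all  *)
(* of its components are.                                                     *)
Definition end_matrix_sum : Prop :=
  exists (k : nat) (m : 'I_k -> nat)
         (phi : rmod_end -> forall i : 'I_k, 'M[F]_((m i).+1)),
    [/\ bijective phi,
        forall i, linear (fun f => phi f i)
      & forall i, GRing.monoid_morphism (fun f => phi f i)].

End EndAlgebra.

Section Presentation.
Variables (F : fieldType) (X : Type).

Inductive alg_term : Type :=
| TGen of X
| TZero
| TAdd of alg_term & alg_term
| TScale of F & alg_term
| TMul of alg_term & alg_term.

HB.instance Definition _ := gen_eqMixin alg_term.
HB.instance Definition _ := gen_choiceMixin alg_term.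

Variable R : alg_term -> alg_term -> Prop.

(* The smallest congruence that contains R and makes the quotient of the term *)
(* algebra an associative, not necessarily unital, F-algebra.                 *)
Inductive alg_cong : alg_term -> alg_term -> Prop :=
| cong_rel x y : R x y -> alg_cong x y
| cong_refl x : alg_cong x x
| cong_sym x y : alg_cong x y -> alg_cong y x
| cong_trans x y z : alg_cong x y -> alg_cong y z -> alg_cong x z
| cong_add x x' y y' :
    alg_cong x x' -> alg_cong y y' -> alg_cong (TAdd x y) (TAdd x' y')
| cong_scale c x x' : alg_cong x x' -> alg_cong (TScale c x) (TScale c x')
| cong_mul x x' y y' :
    alg_cong x x' -> alg_cong y y' -> alg_cong (TMul x y) (TMul x' y')
| cong_addA x y z : alg_cong (TAdd x (TAdd y z)) (TAdd (TAdd x y) z)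
| cong_addC x y : alg_cong (TAdd x y) (TAdd y x)
| cong_add0 x : alg_cong (TAdd TZero x) x
| cong_addN x : alg_cong (TAdd (TScale (-1) x) x) TZero
| cong_scaleA c d x : alg_cong (TScale c (TScale d x)) (TScale (c * d) x)
| cong_scale1 x : alg_cong (TScale 1 x) x
| cong_scaleDr c x y :
    alg_cong (TScale c (TAdd x y)) (TAdd (TScale c x) (TScale c y))
| cong_scaleDl c d x :
    alg_cong (TScale (c + d) x) (TAdd (TScale c x) (TScale d x))
| cong_mulA x y z : alg_cong (TMul x (TMul y z)) (TMul (TMul x y) z)
| cong_mulDl x y z :
    alg_cong (TMul (TAdd x y) z) (TAdd (TMul x z) (TMul y z))
| cong_mulDr x y z :
    alg_cong (TMul x (TAdd y z)) (TAdd (TMul x y) (TMul x z))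
| cong_mulZl c x y : alg_cong (TMul (TScale c x) y) (TScale c (TMul x y))
| cong_mulZr c x y : alg_cong (TMul x (TScale c y)) (TScale c (TMul x y)).

Definition alg_congb : rel alg_term := fun x y => `[< alg_cong x y >].

Fact alg_congb_refl : reflexive alg_congb.
Proof. by move=> x; apply/asboolP; apply: cong_refl. Qed.
Fact alg_congb_sym : symmetric alg_congb.
Proof. by move=> x y; apply/asboolP/asboolP; apply: cong_sym. Qed.
Fact alg_congb_trans : transitive alg_congb.
Proof. by move=> y x z /asboolP h /asboolP k; apply/asboolP; apply: cong_trans h k. Qed.

Canonical alg_cong_equiv :=
  EquivRel alg_congb alg_congb_refl alg_congb_sym alg_congb_trans.

Definition presented_alg : Type := {eq_quot alg_cong_equiv}.

HB.instance Definition _ := Choice.on presented_alg.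
HB.instance Definition _ := Quotient.on presented_alg.

Implicit Types x y z : presented_alg.

Lemma pi_congP (t u : alg_term) :
  alg_cong t u <-> \pi_presented_alg t = \pi_presented_alg u.
Proof. by split=> [h|/eqmodP/asboolP//]; apply/eqmodP/asboolP. Qed.

Lemma repr_cong (t : alg_term) : alg_cong (repr (\pi_presented_alg t)) t.
Proof. by apply/pi_congP; rewrite reprK. Qed.

Definition pres_zero : presented_alg := \pi_presented_alg TZero.
Definition pres_add := lift_op2 presented_alg TAdd.
Definition pres_scale (c : F) := lift_op1 presented_alg (TScale c).
Definition pres_opp x := pres_scale (-1) x.
Definition pres_mul := lift_op2 presented_alg TMul.

Lemma pi_pres_add t u :
  pres_add (\pi_presented_alg t) (\pi_presented_alg u) =
  \pi_presented_alg (TAdd t u).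
Proof.
by unlock pres_add; apply/pi_congP; apply: cong_add; apply: repr_cong.
Qed.
Lemma pi_pres_scale c t :
  pres_scale c (\pi_presented_alg t) = \pi_presented_alg (TScale c t).
Proof.
by unlock pres_scale; apply/pi_congP; apply: cong_scale; apply: repr_cong.
Qed.
Lemma pi_pres_mul t u :
  pres_mul (\pi_presented_alg t) (\pi_presented_alg u) =
  \pi_presented_alg (TMul t u).
Proof.
by unlock pres_mul; apply/pi_congP; apply: cong_mul; apply: repr_cong.
Qed.

Let piE := (pi_pres_add, pi_pres_scale, pi_pres_mul).

Fact pres_addA : associative pres_add.
Proof.
by elim/quotW=> x; elim/quotW=> y; elim/quotW=> z; rewrite !piE;
  apply/pi_congP; apply: cong_addA.
Qed.
Fact pres_addC : commutative pres_add.
Proof.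
by elim/quotW=> x; elim/quotW=> y; rewrite !piE; apply/pi_congP; apply: cong_addC.
Qed.
Fact pres_add0 : left_id pres_zero pres_add.
Proof.
by elim/quotW=> x; rewrite /pres_zero !piE; apply/pi_congP; apply: cong_add0.
Qed.
Fact pres_addN : left_inverse pres_zero pres_opp pres_add.
Proof.
by elim/quotW=> x; rewrite /pres_opp !piE; apply/pi_congP; apply: cong_addN.
Qed.

HB.instance Definition _ := GRing.isZmodule.Build presented_alg
  pres_addA pres_addC pres_add0 pres_addN.

Fact pres_scaleA c d x : pres_scale c (pres_scale d x) = pres_scale (c * d) x.
Proof.
by elim/quotW: x => x; rewrite !piE; apply/pi_congP; apply: cong_scaleA.
Qed.
Fact pres_scale1 : left_id 1 pres_scale.
Proof. by elim/quotW=> x; rewrite !piE; apply/pi_congP; apply: cong_scale1. Qed.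
Fact pres_scaleDr : right_distributive pres_scale +%R.
Proof.
move=> c; elim/quotW=> x; elim/quotW=> y; rewrite /GRing.add/= !piE.
by apply/pi_congP; apply: cong_scaleDr.
Qed.
Fact pres_scaleDl x : {morph pres_scale^~ x : c d / c + d}.
Proof.
move=> c d; elim/quotW: x => x; rewrite [in RHS]/GRing.add/= !piE.
by apply/pi_congP; apply: cong_scaleDl.
Qed.

HB.instance Definition _ := GRing.Zmodule_isLmodule.Build F presented_alg
  pres_scaleA pres_scale1 pres_scaleDr pres_scaleDl.

Fact pres_mulA : associative pres_mul.
Proof.
by elim/quotW=> x; elim/quotW=> y; elim/quotW=> z; rewrite !piE;
  apply/pi_congP; apply: cong_mulA.
Qed.
Fact pres_mulDl : left_distributive pres_mul +%R.
Proof.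
elim/quotW=> x; elim/quotW=> y; elim/quotW=> z; rewrite /GRing.add/= !piE.
by apply/pi_congP; apply: cong_mulDl.
Qed.
Fact pres_mulDr : right_distributive pres_mul +%R.
Proof.
elim/quotW=> x; elim/quotW=> y; elim/quotW=> z; rewrite /GRing.add/= !piE.
by apply/pi_congP; apply: cong_mulDr.
Qed.
Fact pres_mulZl (c : F) x y : pres_mul (c *: x) y = c *: pres_mul x y.
Proof.
elim/quotW: x => x; elim/quotW: y => y; rewrite /GRing.scale/= !piE.
by apply/pi_congP; apply: cong_mulZl.
Qed.
Fact pres_mulZr (c : F) x y : pres_mul x (c *: y) = c *: pres_mul x y.
Proof.
elim/quotW: x => x; elim/quotW: y => y; rewrite /GRing.scale/= !piE.
by apply/pi_congP; apply: cong_mulZr.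
Qed.

HB.instance Definition _ := Lmodule_isNuAlgebra.Build F presented_alg
  pres_mulA pres_mulDl pres_mulDr pres_mulZl pres_mulZr.

End Presentation.

Arguments TZero {F X}.

Record digraph : Type := Digraph {
  vertex : Type;
  arrow : Type;
  source : arrow -> vertex;
  target : arrow -> vertex
}.

Section Paths.
Variable G : digraph.
Implicit Types (v : vertex G) (p q : seq (arrow G)).

(* A path is encoded by its source v and its sequence of arrows; the empty    *)
(* sequence with source v is the path v of length 0.                          *)
Fixpoint is_path v p : Prop :=
  if p is e :: p' then source e = v /\ is_path (target e) p' else True.

Fixpoint path_target v p : vertex G :=
  if p is e :: p' then path_target (target e) p' else v.

Definition sink v : Prop := forall e : arrow G, source e <> v.

Definition leak v : Prop :=
  (forall n : nat, exists! p, is_path v p /\ size p = n) /\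
  (forall p q, is_path v p -> is_path v q -> size p <> size q ->
     path_target v p <> path_target v q).

End Paths.

Section Leavitt.
Variables (F : fieldType) (G : digraph).

Inductive lpa_gen : Type :=
| GVert of vertex G
| GArrow of arrow G
| GStar of arrow G.

Local Notation tm := (alg_term F lpa_gen).
Local Notation V v := (TGen F (GVert v)).
Local Notation E e := (TGen F (GArrow e)).
Local Notation S e := (TGen F (GStar e)).

Inductive lpa_rel : tm -> tm -> Prop :=
| lpa_vertM v : lpa_rel (TMul (V v) (V v)) (V v)
| lpa_vert_orth u v : u <> v -> lpa_rel (TMul (V u) (V v)) TZero
| lpa_source_arrow e : lpa_rel (TMul (V (source e)) (E e)) (E e)
| lpa_arrow_target e : lpa_rel (TMul (E e) (V (target e))) (E e)
| lpa_target_star e : lpa_rel (TMul (V (target e)) (S e)) (S e)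
| lpa_star_source e : lpa_rel (TMul (S e) (V (source e))) (S e)
| lpa_CK1 e : lpa_rel (TMul (S e) (E e)) (V (target e))
| lpa_CK1_orth e f : e <> f -> lpa_rel (TMul (S e) (E f)) TZero
(* The sequence es enumerates the arrows with source v, which is possible     *)
(* exactly when there are finitely many of them.                              *)
| lpa_CK2 v (es : seq {classic arrow G}) :
    es <> [::] -> uniq es -> (forall e, e \in es <-> source e = v) ->
    lpa_rel (V v) (foldr (fun e t => TAdd (TMul (E e) (S e)) t) TZero es).

Definition lpa : Type := presented_alg lpa_rel.

HB.instance Definition _ := NuAlgebra.on lpa.

Definition lpa_vert (v : vertex G) : lpa := \pi_(presented_alg lpa_rel) (V v).
Definition lpa_arrow (e : arrow G) : lpa := \pi_(presented_alg lpa_rel) (E e).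
Definition lpa_star (e : arrow G) : lpa := \pi_(presented_alg lpa_rel) (S e).

Lemma lpa_vert_idem v : lpa_vert v ** lpa_vert v = lpa_vert v.
Proof.
by rewrite [LHS]pi_pres_mul; apply/pi_congP/cong_rel; apply: lpa_vertM.
Qed.

Variable v : vertex G.

Definition vertex_ideal : {pred lpa} :=
  fun x => `[< exists a : lpa, x = lpa_vert v ** a >].

Fact vertex_ideal_submod : submod_closed vertex_ideal.
Proof.
split=> [|c x y /asboolP[a ->] /asboolP[b ->]]; apply/asboolP.
  by exists 0; rewrite -[0 in RHS](scale0r 0) numulZr scale0r.
by exists (c *: a + b); rewrite numulDr numulZr.
Qed.

HB.instance Definition _ :=
  GRing.isSubmodClosed.Build F lpa vertex_ideal vertex_ideal_submod.

Record vertex_mod : Type :=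
  VertexMod { vertex_mod_val :> lpa; _ : vertex_mod_val \in vertex_ideal }.

HB.instance Definition _ := [isSub for vertex_mod_val].
HB.instance Definition _ := [Choice of vertex_mod by <:].
HB.instance Definition _ := [SubChoice_isSubLmodule of vertex_mod by <:].

Fact vertex_mod_act_subproof (x : vertex_mod) (a : lpa) :
  (x : lpa) ** a \in vertex_ideal.
Proof.
case: x => x /asboolP[b /= ->]; apply/asboolP.
by exists (b ** a); rewrite numulA.
Qed.

Definition vertex_mod_act (x : vertex_mod) (a : lpa) : vertex_mod :=
  VertexMod (vertex_mod_act_subproof x a).

Fact vertex_mod_actA x a b :
  vertex_mod_act (vertex_mod_act x a) b = vertex_mod_act x (a ** b).
Proof. by apply: val_inj; rewrite /= numulA. Qed.
Fact vertex_mod_actDl x y a :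
  vertex_mod_act (x + y) a = vertex_mod_act x a + vertex_mod_act y a.
Proof. by apply: val_inj; rewrite /= numulDl. Qed.
Fact vertex_mod_actDr x a b :
  vertex_mod_act x (a + b) = vertex_mod_act x a + vertex_mod_act x b.
Proof. by apply: val_inj; rewrite /= numulDr. Qed.
Fact vertex_mod_actZl c x a :
  vertex_mod_act (c *: x) a = c *: vertex_mod_act x a.
Proof. by apply: val_inj; rewrite /= numulZl. Qed.
Fact vertex_mod_actZr c x a :
  vertex_mod_act x (c *: a) = c *: vertex_mod_act x a.
Proof. by apply: val_inj; rewrite /= numulZr. Qed.

Fact vertex_mod_act_unital (x : vertex_mod) :
  exists s : seq (vertex_mod * lpa), x = \sum_(p <- s) vertex_mod_act p.1 p.2.
Proof.
have v_in : lpa_vert v \in vertex_ideal.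
  by apply/asboolP; exists (lpa_vert v); rewrite lpa_vert_idem.
exists [:: (VertexMod v_in, x : lpa)]; rewrite big_seq1; apply: val_inj => /=.
by case: x => x /asboolP[a /= ->]; rewrite numulA lpa_vert_idem.
Qed.

HB.instance Definition _ := Lmodule_isUnitalRModule.Build F lpa vertex_mod
  vertex_mod_actA vertex_mod_actDl vertex_mod_actDr
  vertex_mod_actZl vertex_mod_actZr vertex_mod_act_unital.

End Leavitt.

(* Main.v *)
Require Import Defs.
From HB Require Import structures.
From mathcomp Require Import all_boot all_order all_algebra.
From mathcomp Require Import boolp functions.

(* For a sink or a leak v, two paths out of v with the same target are equal,  *)
(* and p p^* = v for every path p out of v. Since L is spanned by the p q^*,   *)
(* vLv = F v, and for two such vertices vLu <> 0 only when vL and uL are       *)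
(* isomorphic: End of a sum of such vL is a product of matrix algebras.        *)
(*   Conversely let e <> 0 be an idempotent of a finite dimensional End P. A   *)
(* nonzero matrix entry of e can be multiplied on both sides so as to become   *)
(* b = k w + c with k <> 0 and c a combination of closed paths of positive     *)
(* length at w. If q is such a path, the b q^n b are linearly independent by   *)
(* degree, and give independent endomorphisms; so b = k w, and wL is a direct  *)
(* summand of eP. Now wLw is finite dimensional, so branchings cannot be met   *)
(* forever along the paths out of w, nor can a cycle: some path out of w       *)
(* reaches a sink or a leak u, and uL splits off wL. Splitting such summands   *)
(* off P stops because the projections are independent in End P.               *)

(** Dimension enters only through [indep_le], a bound on the length of independent families. The
    bound passes from End P to a corner wLw ([splits_corner]) and on along arrows, dropping by one
    at a branching ([corner_branch]); hence paths lead from w to a sink or a leak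
    ([corner_terminal]). Nonvanishing and independence cannot be read off the presentation. They
    come from an action of L on functions of graded maximal paths, in which an arrow raises degrees
    by one ([term_act_cong], [indep_path_pow]); [lpa_reduction] brings every nonzero element into
    the range of that argument. A summand wL of P is handled as a pair of y in P and [al] : P -> L
    with [al y] = w. A complete biorthogonal system of such pairs ([dual_bases]) amounts to an
    isomorphism of P with the sum of the w_i L, and turns an endomorphism f into the matrix of the
    al_i (f y_j). Thus [dual_system_complete] and [dual_bases_iso] decompose P when End P is finite
    dimensional, and [dual_bases_matrix_sum] computes End P from a decomposition. *)

Set Implicit Arguments.
Unset Strict Implicit.
Unset Printing Implicit Defensive.

Import Order.TTheory GRing.Theory Num.Theory.
Local Open Scope ring_scope.
Local Open Scope quotient_scope.

(** * Linear spans and independence *)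

Section LinearSpan.
Variable F : fieldType.

Inductive lspan (V : lmodType F) (S : V -> Prop) : V -> Prop :=
| lspan0 : lspan S 0
| lspan_cons c s a : S s -> lspan S a -> lspan S (c *: s + a).

Lemma lspanD (V : lmodType F) (S : V -> Prop) a b :
  lspan S a -> lspan S b -> lspan S (a + b).
Proof.
move=> Sa Sb; elim: Sa => [|c s a' Ss _ IH]; first by rewrite add0r.
by rewrite -addrA; apply: lspan_cons.
Qed.

Lemma lspanZ (V : lmodType F) (S : V -> Prop) c a :
  lspan S a -> lspan S (c *: a).
Proof.
elim=> [|d s a' Ss _ IH]; first by rewrite scaler0; apply: lspan0.
by rewrite scalerDr scalerA; apply: lspan_cons.
Qed.

Lemma lspan_base (V : lmodType F) (S : V -> Prop) s : S s -> lspan S s.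
Proof.
by move=> Ss; rewrite -[s]addr0 -[s]scale1r; apply: lspan_cons => //; apply: lspan0.
Qed.

Lemma lspan_linear (V W : lmodType F) (S : V -> Prop) (T : W -> Prop)
    (f : V -> W) : linear f ->
  (forall s, S s -> lspan T (f s)) -> forall a, lspan S a -> lspan T (f a).
Proof.
move=> lf ST a; elim=> [|c s a' Ss _ IH].
  by have := lf (-1) 0 0; rewrite scaler0 addr0 scaleN1r addNr => ->; apply: lspan0.
by rewrite lf; apply: lspanD => //; apply/lspanZ/ST.
Qed.

Lemma lspan_sub (V : lmodType F) (S T : V -> Prop) :
  (forall s, S s -> lspan T s) -> forall a, lspan S a -> lspan T a.
Proof. by move=> ST; apply: (lspan_linear (f := id)). Qed.

Lemma lspan_neq0 (V W : lmodType F) (S : V -> Prop) (f : V -> W) :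
  linear f -> forall a, lspan S a -> f a <> 0 -> exists2 s, S s & f s <> 0.
Proof.
move=> lf a; elim=> [|c s a' Ss _ IH] fa.
  by case: fa; have := lf (-1) 0 0; rewrite scaler0 addr0 scaleN1r addNr.
have [fs0|fs] := pselect (f s = 0); last by exists s.
by apply: IH => fa0; apply: fa; rewrite lf fs0 fa0 scaler0 addr0.
Qed.

Definition indep (V : lmodType F) (n : nat) (x : nat -> V) : Prop :=
  forall c : nat -> F, \sum_(i < n) c i *: x i = 0 ->
  forall i, (i < n)%N -> c i = 0.

(** This says that the span of S has dimension at most N, without building a vector space on that
    span. *)
Definition indep_le (V : lmodType F) (S : V -> Prop) (N : nat) : Prop :=
  forall n (x : nat -> V), (forall i, S (x i)) -> indep n x -> (n <= N)%N.

Lemma linear_fun_sum (V W : lmodType F) (f : V -> W) (I : Type) (r : seq I)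
    (P : pred I) (x : I -> V) :
  linear f -> f (\sum_(i <- r | P i) x i) = \sum_(i <- r | P i) f (x i).
Proof.
move=> lf; apply: (big_morph f).
  by move=> a b; rewrite -[a]scale1r lf !scale1r.
by have := lf (-1) 0 0; rewrite scaler0 addr0 scaleN1r addNr.
Qed.

Lemma linear_fun_scale (V W : lmodType F) (f : V -> W) c x :
  linear f -> f (c *: x) = c *: f x.
Proof.
move=> lf; have f0 : f 0 = 0.
  by have := lf (-1) 0 0; rewrite scaler0 addr0 scaleN1r addNr.
by rewrite -[c *: x]addr0 lf f0 addr0.
Qed.

Lemma indep_linear (V W : lmodType F) (f : V -> W) n (x : nat -> V) :
  linear f -> indep n (f \o x) -> indep n x.
Proof.
move=> lf fx c c0; apply: fx.
rewrite (eq_bigr (fun i : 'I_n => f (c i *: x i))) => [|i _].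
  by rewrite -linear_fun_sum // c0 -(scale0r 0) linear_fun_scale // scale0r.
by rewrite /= linear_fun_scale.
Qed.

(** Only the retraction g needs to be linear: it carries a relation among the f (x i) back to one
    among the x i. *)
Lemma indep_le_linear (V W : lmodType F) (S : V -> Prop) (T : W -> Prop)
    (f : V -> W) (g : W -> V) N :
  linear g -> (forall x, S x -> T (f x)) -> (forall x, S x -> g (f x) = x) ->
  indep_le T N -> indep_le S N.
Proof.
move=> lg ST fK TN n x Sx ix; apply: (TN n (f \o x)) => [i|]; first exact/ST.
apply: (indep_linear lg) => c.
by rewrite (eq_bigr (fun i : 'I_n => c i *: x i)) => [|i _]; [apply: ix | rewrite /= fK].
Qed.

(** The coordinate rows of an independent family form a matrix of full row rank with d columns. *)
Lemma vector_axiom_indep_le (V : lmodType F) d :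
  Vector.axiom d V -> indep_le (fun _ : V => True) d.
Proof.
case=> v2r lv bv n x _ ix.
pose M := \matrix_(i < n) v2r (x i).
rewrite -[n](_ : \rank M = n) ?rank_leq_col //.
apply/eqP/row_freeP/row_freeP; rewrite -kermx_eq0; apply/eqP/row_matrixP => k.
rewrite row0; set u := row k _.
have uM : u *m M = 0 by rewrite /u -row_mul mulmx_ker row0.
(* [indep] takes coefficients on all of nat, so u is extended by zero. *)
pose c i := if insub i is Some j then u 0 (j : 'I_n) else 0.
have cE (j : 'I_n) : c j = u 0 j by rewrite /c valK.
have c0 : \sum_(i < n) c i *: x i = 0.
  apply: (bij_inj bv); rewrite linear_fun_sum //.
  have -> : v2r 0 = 0 by rewrite -(scale0r 0) linear_fun_scale // scale0r.
  transitivity (u *m M) => //; rewrite mulmx_sum_row; apply: eq_bigr => i _.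
  by rewrite linear_fun_scale // cE rowK.
by apply/rowP=> j; rewrite -cE (ix c c0) ?mxE.
Qed.

End LinearSpan.

(** * Zero, signs and finite sums in non-unital algebras and their modules *)

Section NuAlgebraTheory.
Variables (F : fieldType) (A : nuAlgType F).
Implicit Types x y z : A.

Lemma numul0l y : 0 ** y = 0 :> A.
Proof. by rewrite -[0 in LHS](scale0r 0) numulZl scale0r. Qed.

Lemma numul0r y : y ** 0 = 0 :> A.
Proof. by rewrite -[0 in LHS](scale0r 0) numulZr scale0r. Qed.

Lemma numulNl x y : (- x) ** y = - (x ** y).
Proof. by rewrite -!scaleN1r numulZl. Qed.

Lemma numulBl x y z : (x - y) ** z = x ** z - y ** z.
Proof. by rewrite numulDl numulNl. Qed.

Lemma numul_suml (I : Type) (r : seq I) (P : pred I) (f : I -> A) y :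
  (\sum_(i <- r | P i) f i) ** y = \sum_(i <- r | P i) f i ** y.
Proof.
by apply: (big_morph (fun x => x ** y)) => [a b|]; rewrite (numulDl, numul0l).
Qed.

Lemma numul_sumr (I : Type) (r : seq I) (P : pred I) (f : I -> A) y :
  y ** (\sum_(i <- r | P i) f i) = \sum_(i <- r | P i) y ** f i.
Proof.
by apply: (big_morph (fun x => y ** x)) => [a b|]; rewrite (numulDr, numul0r).
Qed.

Lemma numull_linear y : linear (fun x => y ** x).
Proof. by move=> c a b; rewrite numulDr numulZr. Qed.

Lemma numulr_linear y : linear (fun x => x ** y).
Proof. by move=> c a b; rewrite numulDl numulZl. Qed.

Lemma numul2_linear y z : linear (fun x => y ** x ** z).
Proof. by move=> c a b; rewrite numulDr numulZr numulDl numulZl. Qed.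

Variable M : urmodType A.
Implicit Types u : M.

Lemma ract0l x : 0 *> x = 0 :> M.
Proof. by rewrite -[0 in LHS](scale0r 0) ractZl scale0r. Qed.

Lemma ract0r u : u *> 0 = 0.
Proof. by rewrite -[0 in LHS](scale0r 0) ractZr scale0r. Qed.

Lemma ract_suml (I : Type) (r : seq I) (P : pred I) (f : I -> M) x :
  (\sum_(i <- r | P i) f i) *> x = \sum_(i <- r | P i) f i *> x.
Proof.
by apply: (big_morph (fun u => u *> x)) => [a b|]; rewrite (ractDl, ract0l).
Qed.

End NuAlgebraTheory.

(** * Monomials in a Leavitt path algebra *)

Section Leavitt.
Variables (F : fieldType) (G : digraph).
Local Notation L := (lpa F G).
Local Notation V := (@lpa_vert F G).
Local Notation E := (@lpa_arrow F G).
Local Notation S := (@lpa_star F G).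
Implicit Types (u v w : vertex G) (e f : arrow G) (p q : seq (arrow G)).

Lemma lpa_vertM_orth u v : u <> v -> V u ** V v = 0.
Proof. by move=> uv; rewrite [LHS]pi_pres_mul; apply/pi_congP/cong_rel/lpa_vert_orth. Qed.

Lemma lpa_sourceE e : V (source e) ** E e = E e.
Proof. by rewrite [LHS]pi_pres_mul; apply/pi_congP/cong_rel/lpa_source_arrow. Qed.

Lemma lpa_targetE e : E e ** V (target e) = E e.
Proof. by rewrite [LHS]pi_pres_mul; apply/pi_congP/cong_rel/lpa_arrow_target. Qed.

Lemma lpa_targetS e : V (target e) ** S e = S e.
Proof. by rewrite [LHS]pi_pres_mul; apply/pi_congP/cong_rel/lpa_target_star. Qed.

Lemma lpa_sourceS e : S e ** V (source e) = S e.
Proof. by rewrite [LHS]pi_pres_mul; apply/pi_congP/cong_rel/lpa_star_source. Qed.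

Lemma lpa_SE e : S e ** E e = V (target e).
Proof. by rewrite [LHS]pi_pres_mul; apply/pi_congP/cong_rel/lpa_CK1. Qed.

Lemma lpa_SE_orth e f : e <> f -> S e ** E f = 0.
Proof. by move=> ef; rewrite [LHS]pi_pres_mul; apply/pi_congP/cong_rel/lpa_CK1_orth. Qed.

Lemma lpa_vert_CK2 v (es : seq {classic arrow G}) :
  es <> [::] -> uniq es -> (forall e, e \in es <-> source e = v) ->
  V v = \sum_(e <- es) E e ** S e.
Proof.
move=> es0 ues ves; have /cong_rel/pi_congP := @lpa_CK2 F G v es es0 ues ves.
rewrite /lpa_vert => ->; elim: (es) => [|e r IH]; first by rewrite big_nil.
by rewrite big_cons -IH /= -[LHS]pi_pres_add -[in LHS]pi_pres_mul.
Qed.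

Lemma lpa_vertE u e : u <> source e -> V u ** E e = 0.
Proof. by move=> ue; rewrite -lpa_sourceE numulA lpa_vertM_orth // numul0l. Qed.

Lemma lpa_Svert u e : source e <> u -> S e ** V u = 0.
Proof. by move=> ue; rewrite -lpa_sourceS -numulA lpa_vertM_orth // numul0r. Qed.

(** The argument v matters only for the empty path; on nonempty sequences it is ignored, hence the
    [is_path] hypotheses below. *)
Fixpoint lpa_path v p : L :=
  if p is e :: p' then E e ** lpa_path (target e) p' else V v.

Fixpoint lpa_spath v p : L :=
  if p is e :: p' then lpa_spath (target e) p' ** S e else V v.

Lemma lpa_vert_path v p : is_path v p -> V v ** lpa_path v p = lpa_path v p.
Proof.
case: p => [|e p] /=; first by rewrite lpa_vert_idem.
by case=> <- _; rewrite numulA lpa_sourceE.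
Qed.

Lemma lpa_vert_path_neq u v p :
  is_path v p -> u <> v -> V u ** lpa_path v p = 0.
Proof. by move=> /lpa_vert_path <- uv; rewrite numulA lpa_vertM_orth // numul0l. Qed.

Lemma lpa_path_target v p :
  is_path v p -> lpa_path v p ** V (path_target v p) = lpa_path v p.
Proof.
elim: p v => [|e p IH] v /=; first by rewrite lpa_vert_idem.
by case=> _ /IH; rewrite -numulA => ->.
Qed.

Lemma lpa_spath_vert v p : is_path v p -> lpa_spath v p ** V v = lpa_spath v p.
Proof.
case: p => [|e p] /=; first by rewrite lpa_vert_idem.
by case=> <- _; rewrite -numulA lpa_sourceS.
Qed.

Lemma lpa_spath_vert_neq u v p :
  is_path v p -> u <> v -> lpa_spath v p ** V u = 0.
Proof.
by move=> /lpa_spath_vert <- uv; rewrite -numulA lpa_vertM_orth ?numul0r // => /esym.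
Qed.

Lemma lpa_target_spath v p :
  is_path v p -> V (path_target v p) ** lpa_spath v p = lpa_spath v p.
Proof.
elim: p v => [|e p IH] v /=; first by rewrite lpa_vert_idem.
by case=> _ /IH; rewrite numulA => ->.
Qed.

Lemma lpa_spathK v p : is_path v p ->
  lpa_spath v p ** lpa_path v p = V (path_target v p).
Proof.
elim: p v => [|e p IH] v /=; first by rewrite lpa_vert_idem.
case=> _ pp; rewrite numulA -[_ ** S e ** E e]numulA lpa_SE.
by rewrite lpa_spath_vert // IH.
Qed.

Lemma is_path_cat v p q :
  is_path v (p ++ q) <-> is_path v p /\ is_path (path_target v p) q.
Proof.
elim: p v => [|e p IH] v /=; first by tauto.
by rewrite IH; tauto.
Qed.

Lemma path_target_cat v p q :
  path_target v (p ++ q) = path_target (path_target v p) q.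
Proof. by elim: p v => [|e p IH] v /=. Qed.

Lemma lpa_path_cat v p q : is_path (path_target v p) q ->
  lpa_path v (p ++ q) = lpa_path v p ** lpa_path (path_target v p) q.
Proof.
elim: p v => [|e p IH] v /= qp; first by rewrite lpa_vert_path.
by rewrite IH // numulA.
Qed.

Lemma lpa_spath_cat v p q : is_path (path_target v p) q ->
  lpa_spath v (p ++ q) = lpa_spath (path_target v p) q ** lpa_spath v p.
Proof.
elim: p v => [|e p IH] v /= qp; first by rewrite lpa_spath_vert.
by rewrite IH // numulA.
Qed.

Definition lpa_monomial (a : L) : Prop :=
  exists v p w q, [/\ is_path v p, is_path w q,
    path_target v p = path_target w q & a = lpa_path v p ** lpa_spath w q].

Definition lpa_class (t : alg_term F (lpa_gen G)) : L :=
  \pi_(presented_alg (@lpa_rel F G)) t.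

Lemma lpa_classD t t' : lpa_class (TAdd t t') = lpa_class t + lpa_class t'.
Proof. by rewrite [RHS]pi_pres_add. Qed.

Lemma lpa_classZ c t : lpa_class (TScale c t) = c *: lpa_class t.
Proof. by rewrite [RHS]pi_pres_scale. Qed.

Lemma lpa_classM t t' : lpa_class (TMul t t') = lpa_class t ** lpa_class t'.
Proof. by rewrite [RHS]pi_pres_mul. Qed.

Lemma lpa_classP a : exists t, a = lpa_class t.
Proof. by exists (repr a); rewrite /lpa_class reprK. Qed.

(** An arrow lengthens p; a starred arrow cancels the first arrow of p by CK1 or, when p is trivial,
    lengthens q. Mismatched products vanish. *)
Lemma lpa_monomial_mull (g : lpa_gen G) a :
  lpa_monomial a -> lspan lpa_monomial (lpa_class (TGen F g) ** a).
Proof.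
case=> v [p] [w] [q] [pp qq pq ->].
have mon v' p' w' q' : is_path v' p' -> is_path w' q' ->
    path_target v' p' = path_target w' q' ->
    lspan lpa_monomial (lpa_path v' p' ** lpa_spath w' q').
  by move=> *; apply: lspan_base; exists v', p', w', q'.
case: g => [u|e|e].
- rewrite -[lpa_class _]/(V u) numulA.
  have [->|uv] := pselect (u = v); first by rewrite lpa_vert_path //; apply: mon.
  by rewrite lpa_vert_path_neq // numul0l; apply: lspan0.
- rewrite -[lpa_class _]/(E e) numulA.
  have [ev|ev] := pselect (target e = v); last first.
    rewrite -lpa_targetE -[E e ** _ ** _]numulA lpa_vert_path_neq //.
    by rewrite numul0r numul0l; apply: lspan0.
  by subst v; apply: (mon (source e) (e :: p)).
- rewrite -[lpa_class _]/(S e).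
  case: p pp pq => [|f p] /=.
    move=> _ vq; have [<-|ev] := pselect (source e = v); last first.
      by rewrite numulA lpa_Svert // numul0l; apply: lspan0.
    rewrite numulA lpa_sourceS.
    have [ew|ew] := pselect (path_target w q = source e); last first.
      rewrite -lpa_target_spath // numulA lpa_Svert ?numul0l; last exact/nesym.
      exact: lspan0.
    have qe : is_path w (q ++ [:: e]) by apply/is_path_cat; split=> //=.
    have -> : S e ** lpa_spath w q = V (target e) ** lpa_spath w (q ++ [:: e]).
      by rewrite lpa_spath_cat //= lpa_targetS numulA !lpa_targetS.
    by apply: (mon _ [::]) => //=; rewrite path_target_cat.
  case=> fv pp pq; rewrite !numulA.
  have [?|ef] := pselect (e = f); [subst f | idtac]; last first.
    by rewrite lpa_SE_orth // !numul0l; apply: lspan0.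
  by rewrite lpa_SE lpa_vert_path //; apply: mon.
Qed.

Lemma lpa_span a : lspan lpa_monomial a.
Proof.
(* Stability of the span under left multiplication by all of L, by induction on the left factor. *)
have mul t a' : lspan lpa_monomial a' -> lspan lpa_monomial (lpa_class t ** a').
  elim: t a' => [g|//|t IHt u IHu|c t IHt|t IHt u IHu] a' sa.
  - apply: lspan_linear sa; [exact: numull_linear | exact: lpa_monomial_mull].
  - rewrite -[lpa_class TZero]/(0 : L) numul0l; apply: lspan0.
  - by rewrite lpa_classD numulDl; apply: lspanD; [apply: IHt | apply: IHu].
  - by rewrite lpa_classZ numulZl; apply/lspanZ/IHt.
  - by rewrite lpa_classM -numulA; apply/IHt/IHu.
have mon v p w q : is_path v p -> is_path w q ->
    path_target v p = path_target w q ->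
    lspan lpa_monomial (lpa_path v p ** lpa_spath w q).
  by move=> *; apply: lspan_base; exists v, p, w, q.
have [t ->] := lpa_classP a.
elim: t => [g||t IHt u IHu|c t IHt|t IHt u IHu].
- case: g => [u|e|e].
  + by rewrite -[lpa_class _]/(V u) -lpa_vert_idem; apply: (mon u [::] u [::]).
  + rewrite -[lpa_class _]/(E e) -lpa_targetE -lpa_targetE.
    by apply: (mon (source e) [:: e] (target e) [::]).
  + rewrite -[lpa_class _]/(S e) -lpa_targetS -lpa_targetS.
    by apply: (mon (target e) [::] (source e) [:: e]).
- exact: lspan0.
- by rewrite lpa_classD; apply: lspanD.
- by rewrite lpa_classZ; apply: lspanZ.
- by rewrite lpa_classM; apply: mul.
Qed.

End Leavitt.

(** * A graded action on graded paths *)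

(* A normal path (v, p) represents a maximal path: p itself when it ends at a  *)
(* sink, and otherwise p followed forever by the arrows chosen by [special].   *)
(* Uniqueness of the representation forbids p to end with a chosen arrow.      *)
Section NormalPaths.
Variable G : digraph.
Implicit Types (v : vertex G) (e f : arrow G) (p : seq (arrow G)).
Implicit Types x : vertex G * seq (arrow G).

Definition special v : option (arrow G) :=
  if pselect (exists e, source e = v) is left h then Some (projT1 (cid h))
  else None.

Lemma special_source v e : special v = Some e -> source e = v.
Proof. by rewrite /special; case: pselect => // h [<-]; case: cid. Qed.

Lemma special_exists v e : source e = v -> exists f, special v = Some f.
Proof.
by move=> ev; rewrite /special; case: pselect => [h|[]]; [eexists | exists e].
Qed.

Fixpoint normal v p : Prop :=
  if p is e :: p' then
    [/\ source e = v, normal (target e) p' & p' = [::] -> special v <> Some e]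
  else True.

Definition normal_path x := normal x.1 x.2.

(** At a vertex that is not a sink, the trivial path still starts with an arrow, the chosen one; its
    tail is the trivial path at the target. *)
Definition path_tl e x : option (vertex G * seq (arrow G)) :=
  if x.2 is f :: p then if `[< e = f >] then Some (target e, p) else None
  else if `[< special x.1 = Some e >] then Some (target e, [::]) else None.

(** Prepending a chosen arrow to a trivial path has to give a trivial path again, for the result to
    be normal. *)
Definition path_cons e x : option (vertex G * seq (arrow G)) :=
  if `[< target e = x.1 >] then
    Some (source e, if `[< x.2 = [::] /\ special (source e) = Some e >]
                    then [::] else e :: x.2)
  else None.

(** The last two arguments of [PathTlSome] (removal is undone by insertion, the first arrow is
    unique) yield CK2; those of [PathConsSome] yield CK1. *)
Variant path_tl_spec e x : option (vertex G * seq (arrow G)) -> Prop :=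
| PathTlSome x' of normal_path x' & source e = x.1 & x'.1 = target e
    & path_cons e x' = Some x & (forall f, f <> e -> path_tl f x = None) :
    path_tl_spec e x (Some x')
| PathTlNone : path_tl_spec e x None.

Lemma path_tlP e x : normal_path x -> path_tl_spec e x (path_tl e x).
Proof.
case: x => v [|f p] nx; rewrite /path_tl /=.
  case: asboolP => [se|_]; last exact: PathTlNone.
  apply: PathTlSome => //=; first exact: special_source.
    rewrite /path_cons /= asboolT // asboolT //; first by rewrite (special_source se).
    by rewrite (special_source se).
  by move=> f fe; rewrite /path_tl /= asboolF // se => -[/esym].
case: asboolP => [?|_]; last exact: PathTlNone.
subst f; case: nx => ev nx px; apply: PathTlSome => //=.
  by rewrite /path_cons /= asboolT // asboolF ?ev // => -[/px].
by move=> f fe; rewrite /path_tl /= asboolF.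
Qed.

Variant path_cons_spec e x : option (vertex G * seq (arrow G)) -> Prop :=
| PathConsSome x' of normal_path x' & target e = x.1 & x'.1 = source e
    & path_tl e x' = Some x & (forall f, f <> e -> path_tl f x' = None) :
    path_cons_spec e x (Some x')
| PathConsNone of target e <> x.1 : path_cons_spec e x None.

Lemma path_consP e x : normal_path x -> path_cons_spec e x (path_cons e x).
Proof.
case: x => v p nx; rewrite /path_cons /=.
case: asboolP => [ev|nev]; last exact: PathConsNone.
case: asboolP => [[p0 se]|nse]; apply: PathConsSome => //=.
- by rewrite /path_tl /= asboolT // p0 ev.
- by move=> f fe; rewrite /path_tl /= asboolF // se => -[/esym].
- by split=> // [|p0 se]; [rewrite ev | apply: nse].
- by rewrite /path_tl /= asboolT // ev.
- by move=> f fe; rewrite /path_tl /= asboolF.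
Qed.

Lemma path_tl_exists e x : source e = x.1 -> normal_path x ->
  exists f, path_tl f x <> None /\ source f = x.1.
Proof.
case: x => v [|f p] /= ev nx.
  have [f sf] := special_exists ev; exists f; rewrite /path_tl /= asboolT //.
  by split=> //; apply: special_source.
by case: nx => fv _ _; exists f; rewrite /path_tl /= asboolT.
Qed.

End NormalPaths.

Arguments normal_path : simpl never.
Arguments path_tl : simpl never.
Arguments path_cons : simpl never.

(** * The action on functions and its compatibility with the relations *)

Section Representation.
Variables (F : fieldType) (G : digraph).
Local Notation L := (lpa F G).
Local Notation V := (@lpa_vert F G).
Local Notation E := (@lpa_arrow F G).
Local Notation S := (@lpa_star F G).
Implicit Types (u v w : vertex G) (e f : arrow G) (p q : seq (arrow G)).

Definition graded_path : Type := vertex G * seq (arrow G) * int.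
Implicit Types (y : graded_path) (phi psi : graded_path -> F).

(* Generators act on functions by pulling back along these partial maps. The   *)
(* integer records degrees: without it a cycle without exits would act as 1.   *)
Definition gen_map (g : lpa_gen G) y : option graded_path :=
  if `[< normal_path y.1 >] then
    match g with
    | GVert v => if `[< y.1.1 = v >] then Some y else None
    | GArrow e => omap (fun x => (x, y.2 - 1)) (path_tl e y.1)
    | GStar e => omap (fun x => (x, y.2 + 1)) (path_cons e y.1)
    end
  else None.

(** Functions can be pulled back along any partial map, whereas formal combinations of paths would
    require finite supports. *)
Fixpoint term_act (t : alg_term F (lpa_gen G)) phi y : F :=
  match t with
  | TGen g => if gen_map g y is Some y' then phi y' else 0
  | TZero => 0
  | TAdd t u => term_act t phi y + term_act u phi y
  | TScale c t => c * term_act t phi y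
  | TMul t u => term_act t (term_act u phi) y
  end.

Lemma term_act_linear t c phi psi y :
  term_act t (fun y => c * phi y + psi y) y =
  c * term_act t phi y + term_act t psi y.
Proof.
elim: t phi psi y => [g||t IHt u IHu|d t IHt|t IHt u IHu] phi psi y /=.
- by case: gen_map => [//|]; rewrite mulr0 addr0.
- by rewrite mulr0 addr0.
- by rewrite IHt IHu mulrDr addrACA.
- by rewrite IHt mulrDr mulrCA.
- by rewrite -IHt; congr (term_act t _ y); apply/funext => z; apply: IHu.
Qed.

(** The summand for e acts as the identity at paths that start with e and as zero elsewhere. *)
Lemma term_act_CK2 (r : seq {classic arrow G}) phi x n :
  term_act (foldr (fun e t => TAdd (TMul (TGen F (GArrow e)) (TGen F (GStar e))) t)
    TZero r) phi (x, n) =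
  \sum_(e <- r) if `[< normal_path x >] then
                   if path_tl e x is Some _ then phi (x, n) else 0
                 else 0.
Proof.
elim: r => [|e r IH]; rewrite ?big_nil // big_cons -IH /=; congr (_ + _).
rewrite {1}/gen_map /=; case: asboolP => //= nx.
case: (path_tlP e nx) => //= x' nx' _ _ cx _.
by rewrite /gen_map /= asboolT // cx /= subrK.
Qed.

Lemma term_act_relation t t' : lpa_rel t t' -> term_act t = term_act t'.
Proof.
move=> tt'; apply/funext => phi; apply/funext => -[x n].
case: tt' => [v|u v uv|e|e|e|e|e|e f ef|v es es0 ues ves] /=;
  rewrite /gen_map /=; (case: asboolP => [nx|nx //]).
- by case: asboolP => //= vx; rewrite !asboolT.
- by case: asboolP => //= vx; rewrite asboolT // asboolF // vx.
- case: asboolP => [vx|vx] /=; first by rewrite asboolT.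
  by case: (path_tlP e nx) => //= x' _ /esym.
- case: (path_tlP e nx) => //= x' nx' _ x'e _ _.
  by rewrite !asboolT.
- case: asboolP => [vx|vx] /=; first by rewrite asboolT.
  by case: (path_consP e nx) => //= x' _ /esym.
- case: (path_consP e nx) => //= x' nx' _ x'e _ _.
  by rewrite !asboolT.
- case: (path_consP e nx) => [x' nx' ex x'e tx' _|ex] /=.
    by rewrite !asboolT // tx' /= addrK.
  by rewrite asboolF // => /esym.
- by case: (path_consP e nx) => //= x' nx' _ _ _ fx'; rewrite asboolT // fx' //; apply/nesym.
(* A maximal path out of v has exactly one first arrow, and it occurs in [es], so a single summand
   survives. *)
- rewrite term_act_CK2; case: asboolP => [xv|xv].
    case: es es0 ues ves => [//|e0 es] _ ues ves.
    have e0v : source e0 = x.1 by rewrite xv; apply/ves; rewrite mem_head.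
    have [f [tf fx]] := path_tl_exists e0v nx.
    have fes : (f : {classic arrow G}) \in e0 :: es by apply/ves; rewrite fx.
    rewrite (bigD1_seq (f : {classic arrow G})) //= big1 ?addr0.
      by rewrite asboolT //; case: path_tl tf.
    case: (path_tlP f nx) tf => // x' _ _ _ _ uf _ e /eqP ef.
    by rewrite uf // if_same.
  rewrite big1_seq // => e /andP[_ /ves ev].
  by case: (path_tlP e nx) => [x' _ ex|]; [case: xv; rewrite -ex | rewrite if_same].
- by rewrite term_act_CK2 big1 // => e _; rewrite asboolF.
Qed.

Lemma term_act_cong t t' : alg_cong (@lpa_rel F G) t t' -> term_act t = term_act t'.
Proof.
elim=> {t t'} [t t'|t|t t' _ ->|t t' t'' _ -> _ ->|t t' r r' _ tt' _ rr'|c t t' _ tt'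
  |t t' r r' _ tt' _ rr'|t r s|t r|t|t|c d t|t|c t r|c d t|t r s|t r s|t r s|c t r|c t r];
  rewrite //; try (apply/funext => phi; apply/funext => y /=).
- exact: term_act_relation.
- by rewrite tt' rr'.
- by rewrite tt'.
- by rewrite rr' tt'.
- by rewrite addrA.
- by rewrite addrC.
- by rewrite add0r.
- by rewrite mulN1r addNr.
- by rewrite mulrA.
- by rewrite mul1r.
- by rewrite mulrDr.
- by rewrite mulrDl.
(* Distributivity and scaling in the right factor are where linearity of the action is needed. *)
- have := term_act_linear t 1 (term_act r phi) (term_act s phi) y; rewrite mul1r => <-.
  by congr (term_act t _ y); apply/funext => z /=; rewrite mul1r.
- have := term_act_linear t c (term_act r phi) (fun=> 0) y => tl.
  have t0 : term_act t (fun=> 0) y = 0.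
    have := term_act_linear t (-1) (fun=> 0) (fun=> 0) y.
    by rewrite /= !mulN1r !addNr.
  rewrite t0 addr0 in tl; rewrite -tl; congr (term_act t _ y); apply/funext => z /=.
  by rewrite addr0.
Qed.

Definition lpa_act (a : L) phi y : F := term_act (repr a) phi y.

Lemma lpa_act_class t phi y : lpa_act (lpa_class t) phi y = term_act t phi y.
Proof. by rewrite /lpa_act (term_act_cong (repr_cong _ t)). Qed.

Lemma lpa_actD a b phi y : lpa_act (a + b) phi y = lpa_act a phi y + lpa_act b phi y.
Proof.
have [[t ->] [t' ->]] := (lpa_classP a, lpa_classP b).
by rewrite -lpa_classD !lpa_act_class.
Qed.

Lemma lpa_actZ c a phi y : lpa_act (c *: a) phi y = c * lpa_act a phi y.
Proof. by have [t ->] := lpa_classP a; rewrite -lpa_classZ !lpa_act_class. Qed.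

Lemma lpa_actM a b phi y : lpa_act (a ** b) phi y = lpa_act a (lpa_act b phi) y.
Proof.
have [[t ->] [t' ->]] := (lpa_classP a, lpa_classP b).
rewrite -lpa_classM !lpa_act_class /=; congr (term_act t _ y).
by apply/funext => z; rewrite lpa_act_class.
Qed.

Lemma lpa_act0 phi y : lpa_act 0 phi y = 0.
Proof. by rewrite -(scale0r 0) lpa_actZ mul0r. Qed.

Lemma lpa_act_sum (I : Type) (r : seq I) (a : I -> L) phi y :
  lpa_act (\sum_(i <- r) a i) phi y = \sum_(i <- r) lpa_act (a i) phi y.
Proof.
by apply: (big_morph (fun a => lpa_act a phi y)) => [b c|];
  rewrite (lpa_actD, lpa_act0).
Qed.

(** The degree filtration, which serves to isolate lowest terms. *)
Definition supp_ge (n : int) phi := forall x m, m < n -> phi (x, m) = 0.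

Lemma supp_ge_vert n v phi : supp_ge n phi -> supp_ge n (lpa_act (V v) phi).
Proof.
move=> sp x m mn; rewrite [LHS]lpa_act_class /= /gen_map /=.
by case: asboolP => //= _; case: asboolP => //= _; apply: sp.
Qed.

Lemma supp_ge_arrow n e phi : supp_ge n phi -> supp_ge (n + 1) (lpa_act (E e) phi).
Proof.
move=> sp x m mn; rewrite [LHS]lpa_act_class /= /gen_map /=.
by case: asboolP => //= _; case: path_tl => //= x'; apply: sp; rewrite ltrBlDr.
Qed.

Lemma supp_ge_path n v p phi :
  supp_ge n phi -> supp_ge (n + (size p)%:Z) (lpa_act (lpa_path F v p) phi).
Proof.
move=> sp; elim: p v => [|e p IH] v /=; first by rewrite addr0; apply: supp_ge_vert.
move=> x m mn; rewrite lpa_actM.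
by apply: (supp_ge_arrow e (IH (target e))); rewrite -addrA -PoszD addn1.
Qed.

Lemma lpa_act_vert v x n phi : normal_path x -> x.1 = v ->
  lpa_act (V v) phi (x, n) = phi (x, n).
Proof.
move=> nx xv; rewrite [LHS]lpa_act_class /= /gen_map /=.
by rewrite asboolT // asboolT.
Qed.

(** The point x' is p followed by x; evaluation there undoes the action of p. *)
Lemma lpa_act_path v p x : is_path v p -> normal_path x ->
    x.1 = path_target v p ->
  exists x', [/\ normal_path x', x'.1 = v & forall phi n,
    lpa_act (lpa_path F v p) phi (x', n + (size p)%:Z) = phi (x, n)].
Proof.
elim: p v => [|e p IH] v /=.
  by move=> _ nx xv; exists x; split=> // phi n; rewrite addr0 lpa_act_vert.
case=> ev pp nx xt; have [z [nz ze zE]] := IH _ pp nx xt.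
case: (path_consP e nz) => [x' nx' _ x'e tx' _|]; last by rewrite ze.
exists x'; split=> //; first by rewrite x'e.
move=> phi n; rewrite lpa_actM [LHS]lpa_act_class /= /gen_map /= asboolT // tx' /=.
by rewrite -addn1 PoszD addrA addrK zE.
Qed.

End Representation.

(** * Reduction to vertices and closed paths *)

Section Reduction.
Variables (F : fieldType) (G : digraph).
Local Notation L := (lpa F G).
Local Notation V := (@lpa_vert F G).
Local Notation E := (@lpa_arrow F G).
Local Notation S := (@lpa_star F G).
Implicit Types (u v w : vertex G) (e f : arrow G) (p q : seq (arrow G)).
Implicit Types (a b c : L) (k : F).

Definition path_to m w a : Prop := exists v p,
  [/\ is_path v p, path_target v p = w, (size p <= m)%N & a = lpa_path F v p].

Definition pos_path_to m w a : Prop := exists v p,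
  [/\ is_path v p, path_target v p = w, (0 < size p <= m)%N & a = lpa_path F v p].

Definition closed_path w a : Prop := exists p,
  [/\ is_path w p, path_target w p = w, (0 < size p)%N & a = lpa_path F w p].

(** Only the starred factor is bounded: right multiplication by an arrow shortens it but may
    lengthen p. *)
Definition monomial_to m w a : Prop := exists v p q,
  [/\ is_path v p, is_path w q, path_target v p = path_target w q,
      (size q <= m)%N & a = lpa_path F v p ** lpa_spath F w q].

Definition delta (x : vertex G * seq (arrow G)) : graded_path G -> F :=
  fun y => if `[< y = (x, 0) >] then 1 else 0.

Lemma supp_ge_delta x : supp_ge 0 (delta x).
Proof.
by move=> z m m0; rewrite /delta asboolF // => -[_ m00]; rewrite m00 in m0.
Qed.

Lemma lpa_vert_neq0 w : V w <> 0.
Proof.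
move=> w0; have := lpa_act_vert 0 (delta (w, [::])) (x := (w, [::])) I erefl.
rewrite w0 lpa_act0 /delta asboolT // => /eqP.
by rewrite eq_sym oner_eq0.
Qed.

Lemma supp_ge_lspan (T : L -> Prop) (n d : int) c (phi : graded_path G -> F) :
  (forall s, T s -> supp_ge (n + d) (lpa_act s phi)) -> lspan T c ->
  supp_ge (n + d) (lpa_act c phi).
Proof.
move=> sT; elim=> [|k s c' Ts _ IH] x m mn; first by rewrite lpa_act0.
by rewrite lpa_actD lpa_actZ sT // IH // mulr0 addr0.
Qed.

Lemma supp_ge_pos (n : int) m w c (phi : graded_path G -> F) :
  lspan (pos_path_to m w) c -> supp_ge n phi -> supp_ge (n + 1) (lpa_act c phi).
Proof.
move=> sc sp; apply: supp_ge_lspan sc => _ [v] [p] [_ _ /andP[p0 _] ->] x i ni.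
by apply: (supp_ge_path v sp); apply: lt_le_trans ni _; rewrite lerD2l lez_nat.
Qed.

Lemma supp_ge_closed (n : int) w c (phi : graded_path G -> F) :
  lspan (closed_path w) c -> supp_ge n phi -> supp_ge (n + 1) (lpa_act c phi).
Proof.
move=> sc sp; apply: supp_ge_lspan sc => _ [p] [_ _ p0 ->] x i ni.
by apply: (supp_ge_path w sp); apply: lt_le_trans ni _; rewrite lerD2l lez_nat.
Qed.

Lemma path_to_vert m w a : lspan (path_to m w) a -> a ** V w = a.
Proof.
elim=> [|k s c [v] [p] [pp <- _ ->] _ IH]; first by rewrite numul0l.
by rewrite numulDl numulZl lpa_path_target // IH.
Qed.

Lemma path_to_decomp m w a : lspan (path_to m w) a ->
  exists k c, lspan (pos_path_to m w) c /\ a = k *: V w + c.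
Proof.
elim=> [|k s _ [v] [p] [pp pw pm ->] _ [k' [c [sc ->]]]].
  by exists 0, 0; split; [apply: lspan0 | rewrite scale0r addr0].
case: p pp pw pm => [|e p] pp pw pm.
  exists (k + k'), c; split=> //; rewrite scalerDl addrA /=.
  by rewrite -[v]/(path_target v [::]) pw.
exists k', (k *: lpa_path F v (e :: p) + c); split; last by rewrite addrCA.
by apply: lspan_cons => //; exists v, (e :: p).
Qed.

Lemma pos_path_to0 w c : lspan (pos_path_to 0 w) c -> c = 0.
Proof.
by elim=> // k s a [v] [p] [_ _ /andP[p0 /(leq_trans p0)]].
Qed.

Lemma pos_path_to_star m w c e :
  lspan (pos_path_to m w) c -> lspan (path_to m.-1 w) (S e ** c).
Proof.
apply: lspan_linear; first exact: numull_linear.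
move=> _ [v] [[|f p] [//= [fv pp] pw pm ->]] /=; rewrite numulA.
have [?|ef] := pselect (e = f); last first.
  by rewrite lpa_SE_orth // numul0l; apply: lspan0.
subst f; rewrite lpa_SE lpa_vert_path //; apply: lspan_base.
by exists (target e), p; split=> //; case: m pm.
Qed.

(** A path with first arrow f is fixed by f f^* and killed by the other e e^*. Admitting every
    larger list t lets the lists of several summands be merged. *)
Lemma pos_path_to_sum m w c : lspan (pos_path_to m w) c ->
  exists s : seq {classic arrow G}, forall t, uniq t -> {subset s <= t} ->
    c = \sum_(e <- t) E e ** (S e ** c).
Proof.
elim=> [|k _ c' [v] [[|f p] [//= [fv pp] pw pm ->]] _ [s IH]].
  by exists [::] => t _ _; rewrite big1 // => e _; rewrite !numul0r.
exists ((f : {classic arrow G}) :: s) => t ut st.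
have ft : (f : {classic arrow G}) \in t by apply: st; rewrite mem_head.
have /IH-/(_ ut) cE : {subset s <= t} by move=> e es; apply: st; rewrite inE es orbT.
under eq_bigr do rewrite !numulDr !numulZr.
rewrite big_split /= -cE; congr (_ + _).
rewrite (bigD1_seq (f : {classic arrow G})) //= big1 ?addr0 => [|e /eqP ef].
  by rewrite [S f ** _]numulA lpa_SE lpa_vert_path.
by rewrite [S e ** _]numulA lpa_SE_orth // numul0l numul0r scaler0.
Qed.

(** The coefficient of the trivial path is detected in the lowest degree; what is left is treated by
    stripping first arrows, since f^* c is made of shorter paths and is killed by e as well. *)
Lemma path_to_arrow_eq0 m w a e : lspan (path_to m w) a -> source e = w ->
  a ** E e = 0 -> a = 0.
Proof.
elim: m a => [|m IH] a sa ew ae0; have [k [c [sc aE]]] := path_to_decomp sa;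
  (have k0 : k = 0; [| rewrite aE k0 scale0r add0r in sa ae0 *]).
(* Proof of [k = 0]: at e followed by the trivial path, in degree one, the term k w e contributes k,
   while c e only reaches degrees at least two. *)
1,3: have pe : is_path w [:: e] by [].
1,2: have [x [nx xw xE]] := @lpa_act_path F G w [:: e] (target e, [::]) pe I erefl.
1,2: have := lpa_act0 (delta (target e, [::])) (x, 1); rewrite -ae0 lpa_actM aE.
1,2: have s1 : supp_ge 1 (lpa_act (E e) (delta (target e, [::])))
       by rewrite -[1]add0r; apply/supp_ge_arrow/supp_ge_delta.
1,2: rewrite lpa_actD lpa_actZ (supp_ge_pos sc s1) // addr0 lpa_act_vert //.
1,2: have := xE (delta (target e, [::])) 0; rewrite /= lpa_targetE add0r => ->.
1,2: by rewrite /delta asboolT // mulr1.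
  exact: pos_path_to0 sc.
have [s cE] := pos_path_to_sum sc.
rewrite (cE (undup s)) ?undup_uniq // => [|f]; last by rewrite mem_undup.
rewrite big1 // => f _; rewrite (IH (S f ** c)) ?numul0r //.
  exact: pos_path_to_star sc.
by rewrite -numulA ae0 numul0r.
Qed.

Lemma lspan_closed_vert m w c :
  lspan (pos_path_to m w) c -> lspan (closed_path w) (V w ** c).
Proof.
apply: lspan_linear; first exact: numull_linear.
move=> _ [v] [p] [pp pw /andP[p0 _] ->].
have [?|vw] := pselect (w = v); last first.
  by rewrite lpa_vert_path_neq //; apply: lspan0.
by subst v; rewrite lpa_vert_path //; apply: lspan_base; exists p.
Qed.

(** If the trivial path has a nonzero coefficient, multiplying by w keeps just the closed paths.
    Otherwise some e^* a is nonzero and consists of shorter paths. *)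
Lemma left_reduction m w a : lspan (path_to m w) a -> a <> 0 ->
  exists x k c, [/\ k != 0, lspan (closed_path w) c, V w ** x = x &
    x ** a = k *: V w + c].
Proof.
elim: m a => [|m IH] a sa a0; have [k [c [sc aE]]] := path_to_decomp sa;
  (have [k0|kn0] := eqVneq k 0;
   [rewrite aE k0 scale0r add0r in a0
   |exists (V w), k, (V w ** c); split=> //;
     [exact: lspan_closed_vert sc | exact: lpa_vert_idem
     |by rewrite aE numulDr numulZr lpa_vert_idem]]).
  by case: a0; exact: (pos_path_to0 sc).
have [[e ec]|nec] := pselect (exists e, S e ** c <> 0).
  have [x [k' [c' [k'0 sc' wx xE]]]] := IH _ (pos_path_to_star e sc) ec.
  exists (x ** S e), k', c'; split=> //; first by rewrite numulA wx.
  by rewrite aE k0 scale0r add0r -numulA.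
case: a0; have [s cE] := pos_path_to_sum sc.
rewrite (cE (undup s)) ?undup_uniq // => [|f]; last by rewrite mem_undup.
rewrite big1 // => f _; have [->|fc] := pselect (S f ** c = 0).
  exact: numul0r.
by case: nec; exists f.
Qed.

Lemma monomial_to_arrow m w e a : source e = w -> lspan (monomial_to m.+1 w) a ->
  lspan (monomial_to m (target e)) (a ** E e).
Proof.
move=> ew; apply: (lspan_linear (f := fun a => a ** E e)).
  exact: numulr_linear.
move=> _ [v] [p] [[|f q] [pp qq pq qm ->]] /=; rewrite -!numulA.
  apply: lspan_base; exists v, (p ++ [:: e]), [::]; split=> //.
  - by apply/is_path_cat; split=> //=; rewrite pq.
  - by rewrite path_target_cat.
  rewrite lpa_path_cat /=; last by rewrite pq.
  by rewrite -!numulA lpa_vert_idem lpa_targetE -ew lpa_sourceE.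
have [?|fe] := pselect (f = e); last first.
  by rewrite lpa_SE_orth // !numul0r; apply: lspan0.
subst f; rewrite lpa_SE lpa_spath_vert //; last by case: qq.
by apply: lspan_base; exists v, p, q; case: qq.
Qed.

Lemma path_to_leq m n w a :
  (m <= n)%N -> lspan (path_to m w) a -> lspan (path_to n w) a.
Proof.
move=> mn; apply: lspan_sub => b [v] [p] [pp pw pm ->].
by apply: lspan_base; exists v, p; split=> //; apply: leq_trans mn.
Qed.

Lemma path_toD m n w a b : lspan (path_to m w) a -> lspan (path_to n w) b ->
  lspan (path_to (maxn m n) w) (a + b).
Proof.
move=> sa sb; apply: lspanD.
  exact: path_to_leq (leq_maxl _ _) sa.
exact: path_to_leq (leq_maxr _ _) sb.
Qed.

Lemma monomial_to0 w a : lspan (monomial_to 0 w) a ->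
  exists m, lspan (path_to m w) a.
Proof.
elim=> [|k _ b [v] [p] [[|f q] [pp _ /= pw // _ ->]] _ [m sb]].
  by exists 0%N; apply: lspan0.
exists (maxn (size p) m); apply: path_toD => //; apply/lspanZ/lspan_base.
by exists v, p; split=> //; rewrite -pw lpa_path_target.
Qed.

(** The element [a0] collects the monomials with trivial q. Any other one is fixed on the right by f
    f^*, for f the first arrow of q, and killed by the other e e^*. *)
Lemma monomial_to_split m w a : lspan (monomial_to m w) a ->
  exists n a0, exists2 s : seq {classic arrow G}, lspan (path_to n w) a0 &
    forall t, uniq t -> {subset s <= t} ->
      a - a0 = \sum_(e <- t) (a - a0) ** E e ** S e.
Proof.
elim=> [|k _ b [v] [p] [[|f q] [pp qq /= pq qm ->]] _ [n [b0 [s sb0 IH]]]].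
- exists 0%N, 0; exists [::]; first exact: lspan0.
  by move=> t _ _; rewrite subrr big1 // => e _; rewrite !numul0l.
- exists (maxn (size p) n), (k *: lpa_path F v p + b0); exists s.
    by apply: path_toD => //; apply/lspanZ/lspan_base; exists v, p.
  by rewrite -pq lpa_path_target // opprD addrACA subrr add0r.
exists n, b0; exists ((f : {classic arrow G}) :: s) => // t ut st.
have ft : (f : {classic arrow G}) \in t by apply: st; rewrite mem_head.
have /IH-/(_ ut) cE : {subset s <= t} by move=> e es; apply: st; rewrite inE es orbT.
rewrite -addrA; under eq_bigr do rewrite (numulDl _ (b - b0)) numulDl !numulZl.
rewrite big_split /= -cE; congr (_ + _).
rewrite (bigD1_seq (f : {classic arrow G})) //= big1 ?addr0 => [|e /eqP ef].
  rewrite -!numulA [S f ** (_ ** _)]numulA lpa_SE.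
  by rewrite [V _ ** _]lpa_targetS.
rewrite -!numulA [S f ** (_ ** _)]numulA lpa_SE_orth ?numul0l ?numul0r ?scaler0 //.
exact/nesym.
Qed.

(** Multiplying by an arrow out of w shortens the starred factors, so the difficulty is an a killed
    by every arrow. If some arrow at w lies outside the finite list of [monomial_to_split], it kills
    the starred part, hence the unstarred part b, and b = 0 by [path_to_arrow_eq0]; then a = 0. If
    not, w emits finitely many arrows: CK2 gives a = 0, unless w is a sink, where every q is
    trivial. *)
Lemma right_reduction m w a : lspan (monomial_to m w) a -> a <> 0 ->
  exists y n w', lspan (path_to n w') (a ** y) /\ a ** y <> 0.
Proof.
elim: m w a => [|m IH] w a sa a0.
  have [n sna] := monomial_to0 sa.
  by exists (V w), n, w; rewrite (path_to_vert sna).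
have [[e [ew ae]]|nae] := pselect (exists e, source e = w /\ a ** E e <> 0).
  have [y [n [w' [sy ay]]]] := IH _ _ (monomial_to_arrow ew sa) ae.
  by exists (E e ** y), n, w'; rewrite numulA.
have {}nae e : source e = w -> a ** E e = 0.
  by move=> ew; have [//|ae] := pselect (a ** E e = 0); case: nae; exists e.
have aw : a ** V w = a.
  elim: sa => [|k _ b [v] [p] [q [_ qq _ _ ->]] _ IHb]; first by rewrite numul0l.
  by rewrite numulDl numulZl IHb -numulA lpa_spath_vert.
have ae0 e : a ** E e = 0.
  have [/nae//|ew] := pselect (source e = w).
  by rewrite -aw -numulA lpa_vertE ?numul0r //; apply/nesym.
have [n [b [s sb aE]]] := monomial_to_split sa.
have [[e [ew es]]|nes] :=
    pselect (exists e : {classic arrow G}, source e = w /\ e \notin undup s).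
  have us : {subset s <= undup s} by move=> f; rewrite mem_undup.
  have abe : (a - b) ** E e = 0.
    rewrite (aE (undup s)) ?undup_uniq // numul_suml big1_seq // => f /andP[_ fs].
    rewrite -numulA lpa_SE_orth ?numul0r // => fe.
    by rewrite fe (negPf es) in fs.
  have b0 : b = 0.
    apply: (path_to_arrow_eq0 sb ew).
    by move/eqP: abe; rewrite numulBl ae0 sub0r oppr_eq0 => /eqP.
  case: a0; rewrite -[a]subr0 -b0 (aE (undup s)) ?undup_uniq // big1 // => f _.
  by rewrite b0 subr0 ae0 numul0l.
have [[e ew]|ns] := pselect (exists e : arrow G, source e = w).
  pose es : seq {classic arrow G} := [seq f <- undup s | `[< source f = w >]].
  have esP (f : {classic arrow G}) : f \in es <-> source f = w.
    rewrite mem_filter; split=> [/andP[/asboolP]//|fw].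
    apply/andP; split; first exact/asboolP.
    by apply: contrapT => /negP fs; apply: nes; exists f.
  case: a0; rewrite -aw (@lpa_vert_CK2 F G w es) ?filter_uniq ?undup_uniq //.
    by rewrite numul_sumr big1 // => f _; rewrite numulA ae0 numul0l.
  by move=> es0; have /esP := ew; rewrite es0.
have [n' ska] : exists n', lspan (path_to n' w) a.
  apply: monomial_to0; apply: lspan_sub sa => _ [v] [p] [[|f q] [pp qq pq qm ->]].
    by apply: lspan_base; exists v, p, [::].
  by case: ns; exists f; case: qq.
by exists (V w), n', w; rewrite aw.
Qed.

Lemma lpa_local_unit a : exists s : seq {classic vertex G}, forall t,
  uniq t -> {subset s <= t} -> a = \sum_(w <- t) a ** V w.
Proof.
elim: (lpa_span a) => [|k _ b [v] [p] [w [q [pp qq pq ->]]] _ [s IH]].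
  by exists [::] => t _ _; rewrite big1 // => w _; rewrite numul0l.
exists ((w : {classic vertex G}) :: s) => t ut st.
have wt : (w : {classic vertex G}) \in t by apply: st; rewrite mem_head.
have /IH-/(_ ut) cE : {subset s <= t} by move=> e es; apply: st; rewrite inE es orbT.
under eq_bigr do rewrite numulDl numulZl.
rewrite big_split /= -cE; congr (_ + _).
rewrite (bigD1_seq (w : {classic vertex G})) //= big1 ?addr0 => [|u /eqP uw].
  by rewrite -numulA lpa_spath_vert.
by rewrite -numulA lpa_spath_vert_neq // numul0r scaler0.
Qed.

Lemma monomial_to_vert a w : exists m, lspan (monomial_to m w) (a ** V w).
Proof.
elim: (lpa_span a) => [|k _ b [v] [p] [u [q [pp qq pq ->]]] _ [m IH]].
  by exists 0%N; rewrite numul0l; apply: lspan0.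
exists (maxn (size q) m); rewrite numulDl numulZl; apply: lspanD; last first.
  apply: lspan_sub IH => _ [v'] [p'] [q' [? ? ? qm ->]].
  apply: lspan_base; exists v', p', q'; split=> //.
  by rewrite leq_max qm orbT.
rewrite -numulA; have [?|uw] := pselect (w = u); last first.
  by rewrite lpa_spath_vert_neq // numul0r scaler0; apply: lspan0.
subst u; rewrite lpa_spath_vert //; apply/lspanZ/lspan_base.
by exists v, p, q; split=> //; rewrite leq_maxl.
Qed.

(** The reduction theorem: the right factor removes the stars, then the left one isolates a nonzero
    multiple of a vertex. *)
Lemma lpa_reduction a : a <> 0 -> exists w x y k c,
  [/\ k != 0, lspan (closed_path w) c, V w ** x = x, y ** V w = y &
    x ** a ** y = k *: V w + c].
Proof.
move=> a0; have [w aw] : exists w, a ** V w <> 0.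
  apply: contrapT => naw; apply: a0; have [s aE] := lpa_local_unit a.
  rewrite (aE (undup s)) ?undup_uniq // => [|w]; last by rewrite mem_undup.
  rewrite big1 // => w _; apply: contrapT => aw.
  by apply: naw; exists w.
have [m sa] := monomial_to_vert a w.
have [y [n [w' [sy ay]]]] := right_reduction sa aw.
have [x [k [c [k0 sc wx xE]]]] := left_reduction sy ay.
exists w', x, (V w ** y ** V w'), k, c; split=> //.
  by rewrite -numulA lpa_vert_idem.
by rewrite -xE -[in RHS](path_to_vert sy) !numulA.
Qed.

Definition path_pow w q i : L := iter i (fun x => lpa_path F w q ** x) (V w).

Lemma supp_ge_pow n w q i (phi : graded_path G -> F) : supp_ge n phi ->
  supp_ge (n + (i * size q)%:Z) (lpa_act (path_pow w q i) phi).
Proof.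
move=> sp; elim: i => [|i IH]; first by rewrite addr0; apply: supp_ge_vert.
move=> x m mn /=; rewrite lpa_actM; apply: (supp_ge_path w IH).
by rewrite -addrA -PoszD addnC -mulSn.
Qed.

Lemma lpa_act_pow w q i : is_path w q -> path_target w q = w ->
  exists x, [/\ normal_path x, x.1 = w & forall phi : graded_path G -> F,
    lpa_act (path_pow w q i) phi (x, (i * size q)%:Z) = phi ((w, [::]), 0)].
Proof.
move=> qq qw; elim: i => [|i [z [nz zw zE]]].
  exists (w, [::]); split=> // phi; exact: lpa_act_vert.
have zt : z.1 = path_target w q by rewrite qw.
have [x [nx xw xE]] := lpa_act_path F qq nz zt; exists x; split=> // phi /=.
by rewrite lpa_actM mulSn addnC PoszD xE zE.
Qed.

(* Lowest terms in the grading: [b q^n b = k^2 q^n + higher terms]. *)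
Lemma indep_path_pow w k c q n : k != 0 -> lspan (closed_path w) c ->
  is_path w q -> path_target w q = w -> (0 < size q)%N ->
  indep n (fun i => (k *: V w + c) ** path_pow w q i ** (k *: V w + c)).
Proof.
move=> k0 sc qq qw q0 d dE; set b := _ + c in dE.
pose phi := delta (w, [::]); pose psi := lpa_act b phi.
(* On lowest terms, at paths out of w, b acts as the scalar k. *)
have act_b m (f : graded_path G -> F) x : normal_path x -> x.1 = w ->
    supp_ge m f -> lpa_act b f (x, m) = k * f (x, m).
  move=> nx xw sf; rewrite lpa_actD lpa_actZ lpa_act_vert //.
  by rewrite (supp_ge_closed sc sf) ?addr0 // ltrDl.
have ge_b m (f : graded_path G -> F) : supp_ge m f -> supp_ge m (lpa_act b f).
  move=> sf x i im; rewrite lpa_actD lpa_actZ (supp_ge_vert _ sf) // mulr0 add0r.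
  by apply: (supp_ge_closed sc sf); apply: lt_trans im _; rewrite ltrDl.
have psi0 : supp_ge 0 psi by apply/ge_b/supp_ge_delta.
elim/ltn_ind=> j IH jn.
(* Evaluation at q^j in degree j |q|: the terms with i < j vanish by induction, those with i > j by
   degree. *)
have [x [nx xw xE]] := lpa_act_pow j qq qw.
have := lpa_act0 phi (x, (j * size q)%:Z); rewrite -[in X in X -> _]dE lpa_act_sum.
rewrite (bigD1 (Ordinal jn)) //= big1 ?addr0 => [|i ij].
  rewrite lpa_actZ !lpa_actM act_b //; last first.
    by rewrite -[(_ * _)%N%:Z]add0r; apply: supp_ge_pow.
  rewrite xE act_b //; last exact: supp_ge_delta.
  rewrite /phi /delta asboolT // mulr1.
  by move/eqP; rewrite !mulf_eq0 (negPf k0) !orbF => /eqP.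
rewrite lpa_actZ; have [ij'|ij'|ij'] := ltngtP (i : nat) j.
- by rewrite IH // mul0r.
- rewrite !lpa_actM; set g := lpa_act _ psi.
  have sg : supp_ge (0 + (i * size q)%:Z) g by apply: supp_ge_pow.
  by rewrite (ge_b _ _ sg) ?mulr0 // add0r ltz_nat ltn_pmul2r.
- by case/eqP: ij; apply: val_inj.
Qed.

End Reduction.

(** * Corners at sinks and leaks *)

Section Terminal.
Variables (F : fieldType) (G : digraph).
Local Notation L := (lpa F G).
Local Notation V := (@lpa_vert F G).
Local Notation E := (@lpa_arrow F G).
Local Notation S := (@lpa_star F G).
Implicit Types (u v w : vertex G) (e f : arrow G) (p q : seq (arrow G)).
Implicit Types (a b c : L) (k : F).

Definition terminal v : Prop := sink v \/ leak v.

Definition unbranched v : Prop := forall p e f, is_path v p ->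
  source e = path_target v p -> source f = path_target v p -> e = f.

Lemma terminal_unbranched v : terminal v -> unbranched v.
Proof.
case=> [sv|[lv _]] p e f pp ep fp.
  by case: p pp ep fp => [|e' p] /=; [move=> _ /sv | case=> /sv].
have [r [_ ru]] := lv (size p).+1.
have pe g : source g = path_target v p -> r = p ++ [:: g].
  move=> gp; apply: ru; split; first by apply/is_path_cat.
  by rewrite size_cat addn1.
have := congr1 (last e) (pe f fp); rewrite (pe e ep) !last_cat /=.
by [].
Qed.

Lemma terminal_path_inj v p q : terminal v -> is_path v p -> is_path v q ->
  path_target v p = path_target v q -> p = q.
Proof.
case=> [sv|[lv tv]] pp qq pq.
  by case: p q pp qq {pq} => [|e p] [|f q] //= => [_ [/sv]|[/sv]|[/sv]].
have [spq|spq] := pselect (size p = size q); last by case: (tv p q).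
have [r [_ ru]] := lv (size q).
by rewrite -(ru p) // -(ru q).
Qed.

(** CK2 at a vertex with a single arrow e reads v = e e^*; this is iterated along p. *)
Lemma unbranched_spathK v p : unbranched v -> is_path v p ->
  lpa_path F v p ** lpa_spath F v p = V v.
Proof.
elim: p v => [|e p IH] v uv /=; first by rewrite lpa_vert_idem.
case=> ev pp.
have ue : unbranched (target e) by move=> q f g qq; apply: (uv (e :: q)).
rewrite -numulA [lpa_path _ _ _ ** _]numulA IH // lpa_targetS.
rewrite (@lpa_vert_CK2 F G v [:: e]) ?big_seq1 // => f.
rewrite (@mem_seq1 {classic arrow G}); split=> [/eqP->//|fv]; apply/eqP.
exact: (uv [::]).
Qed.

(** A monomial p q^* in the corner has p and q starting at v with the same target; then p = q and
    the monomial is v. *)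
Lemma terminal_corner v a : terminal v -> exists k, V v ** a ** V v = k *: V v.
Proof.
move=> tv.
have : lspan (fun b => b = V v) (V v ** a ** V v).
  apply: (lspan_linear (numul2_linear _ _)) (lpa_span a).
  move=> _ [u [p [w [q [pp qq pq ->]]]]]; rewrite -!numulA.
  have [?|wv] := pselect (v = w); last first.
    by rewrite lpa_spath_vert_neq // !numul0r; apply: lspan0.
  have [?|uv] := pselect (v = u); last first.
    by rewrite numulA lpa_vert_path_neq // numul0l; apply: lspan0.
  subst u w; rewrite numulA lpa_vert_path // lpa_spath_vert //.
  rewrite (terminal_path_inj tv pp qq pq) unbranched_spathK //.
    exact: lspan_base.
  exact: terminal_unbranched.
elim=> [|k _ b -> _ [k' ->]]; first by exists 0; rewrite scale0r.
by exists (k + k'); rewrite scalerDl.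
Qed.

(** Equivalence of the idempotents v and u, that is, isomorphism of vL and uL. *)
Definition vert_equiv v u : Prop := exists x y : L,
  [/\ V v ** x = x, x ** V u = x, V u ** y = y, y ** V v = y
    & x ** y = V v /\ y ** x = V u].

Lemma vert_equiv_refl v : vert_equiv v v.
Proof. by exists (V v), (V v); rewrite lpa_vert_idem. Qed.

Lemma vert_equiv_sym v u : vert_equiv v u -> vert_equiv u v.
Proof. by case=> x [y [? ? ? ? [? ?]]]; exists y, x. Qed.

Lemma vert_equiv_trans v u w :
  vert_equiv v u -> vert_equiv u w -> vert_equiv v w.
Proof.
case=> x [y [vx xu uy yv [xy yx]]] [x' [y' [ux' x'w wy' y'u [xy' yx']]]].
exists (x ** x'), (y' ** y); split; rewrite ?numulA ?vx ?wy' //.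
- by rewrite -numulA x'w.
- by rewrite -numulA yv.
- by rewrite -[x ** x' ** y']numulA xy' xu xy -[y' ** y ** x]numulA yx y'u yx'.
Qed.

(** A nonzero product comes from paths p out of v and q out of u with the same target; p q^* and q
    p^* are then mutually inverse. *)
Lemma terminal_hom v u a : terminal v -> terminal u -> ~ vert_equiv v u ->
  V v ** a ** V u = 0.
Proof.
move=> tv tu nvu; apply: contrapT => a0; apply: nvu.
have [_ [v' [p [u' [q [pp qq pq ->]]]]]] :=
  lspan_neq0 (numul2_linear (V v) (V u)) (lpa_span a) a0.
rewrite -!numulA; have [?|uu] := pselect (u = u'); last first.
  by rewrite lpa_spath_vert_neq // !numul0r.
have [?|vv] := pselect (v = v'); last first.
  by rewrite numulA lpa_vert_path_neq // numul0l.
subst u' v' => _; exists (lpa_path F v p ** lpa_spath F u q).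
exists (lpa_path F u q ** lpa_spath F v p); split; last split.
- by rewrite numulA lpa_vert_path.
- by rewrite -numulA lpa_spath_vert.
- by rewrite numulA lpa_vert_path.
- by rewrite -numulA lpa_spath_vert.
- rewrite -numulA [lpa_spath _ _ _ ** _]numulA lpa_spathK // -pq.
  by rewrite lpa_target_spath // unbranched_spathK //; apply: terminal_unbranched.
- rewrite -numulA [lpa_spath _ _ _ ** _]numulA lpa_spathK // pq.
  by rewrite lpa_target_spath // unbranched_spathK //; apply: terminal_unbranched.
Qed.

Definition corner w a : Prop := V w ** a ** V w = a.

Lemma corner_no_cycle N w q : is_path w q -> path_target w q = w ->
  (0 < size q)%N -> ~ indep_le (corner w) N.
Proof.
move=> qq qw q0 /(_ N.+1) => small.
have := indep_path_pow (n := N.+1) (oner_neq0 F) (lspan0 _) qq qw q0.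
rewrite addr0 scale1r => /small; rewrite ltnn => sm.
suff: false by []; apply: sm => i.
by rewrite /corner -!numulA lpa_vert_idem !numulA lpa_vert_idem.
Qed.

Lemma corner_step N e :
  indep_le (corner (source e)) N -> indep_le (corner (target e)) N.
Proof.
apply: (@indep_le_linear _ _ _ _ _ (fun x => E e ** x ** S e)
                                    (fun x => S e ** x ** E e)).
- exact: numul2_linear.
- by move=> x _; rewrite /corner -!numulA lpa_sourceS !numulA lpa_sourceE.
- by move=> x ex; rewrite !numulA lpa_SE -numulA lpa_SE.
Qed.

Lemma corner_path N w p : is_path w p ->
  indep_le (corner w) N -> indep_le (corner (path_target w p)) N.
Proof.
elim: p w => [//|e p IH] w /= [ew pp] small.
by apply: IH => //; apply: corner_step; rewrite ew.
Qed.

(** Independent elements x_i of the target corner give e x_i e^* in the source corner, and f f^* is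
    independent of these: compressing by f^* and f kills them all. *)
Lemma corner_branch N e f : e <> f -> source e = source f ->
  indep_le (corner (source e)) N.+1 -> indep_le (corner (target e)) N.
Proof.
move=> ef sef small n x xe ix; rewrite -ltnS.
apply: (small n.+1 (fun i => if (i < n)%N then E e ** x i ** S e else E f ** S f)).
  move=> i; rewrite /corner; case: ifP => _.
    by rewrite -!numulA lpa_sourceS !numulA lpa_sourceE.
  by rewrite sef -!numulA lpa_sourceS !numulA lpa_sourceE.
move=> c; rewrite big_ord_recr /= ltnn; under eq_bigr do rewrite ltn_ord.
move=> c0; have SfEe y z : S f ** (E e ** y ** z) = 0.
  by rewrite !numulA lpa_SE_orth ?numul0l //; apply/nesym.
have cn : c n = 0.
  have := congr1 (fun y => S f ** y ** E f) c0.
  rewrite numulDr numul_sumr big1 ?add0r => [|i _]; last first.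
    by rewrite numulZr SfEe scaler0.
  rewrite numulZr numulA lpa_SE numulZl -numulA lpa_SE lpa_vert_idem.
  rewrite numul0r numul0l => /eqP; rewrite scaler_eq0 => /orP[/eqP//|/eqP].
  by move/lpa_vert_neq0.
have {}ix := ix c; move=> i; rewrite ltnS leq_eqVlt => /orP[/eqP->//|].
apply: ix; have := congr1 (fun y => S e ** y ** E e) c0.
rewrite cn scale0r addr0 numul_sumr numul_suml numul0r numul0l => c00.
rewrite -[RHS]c00; apply: eq_bigr => {}i _; rewrite numulZr numulZl !numulA lpa_SE -numulA lpa_SE.
by rewrite xe.
Qed.

(** Induction on N: behind a reachable branching the bound is smaller, and it cannot be 0 because w
    itself is nonzero. With no branching and no reachable sink there is one path of each length, and
    a repeated target would give a cycle, against [corner_no_cycle]; so w is a leak. *)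
Lemma corner_terminal N w : indep_le (corner w) N ->
  exists p, is_path w p /\ terminal (path_target w p).
Proof.
elim: N w => [|N IH] w small.
  have : (1 <= 0)%N; last by [].
  apply: (small 1 (fun=> V w)) => [_|c]; first by rewrite /corner !lpa_vert_idem.
  rewrite big_ord1 => /eqP; rewrite scaler_eq0 => /orP[/eqP c0 [|i]//|/eqP].
  by move/lpa_vert_neq0.
have [[p [e [f [pp ep fp ef]]]]|nbr] := pselect (exists p e f, [/\ is_path w p,
    source e = path_target w p, source f = path_target w p & e <> f]).
  have sm : indep_le (corner (target e)) N.
    by apply: (corner_branch ef); rewrite ep ?fp //; apply: corner_path.
  have [q [qq tq]] := IH _ sm; exists (p ++ e :: q).
  by rewrite path_target_cat; split=> //; apply/is_path_cat.
have {}nbr : unbranched w.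
  move=> p e f pp ep fp; apply: contrapT => ef.
  by apply: nbr; exists p, e, f.
have [[p [pp sp]]|ns] := pselect (exists p, is_path w p /\ sink (path_target w p)).
  by exists p; split=> //; left.
have ext p : is_path w p -> exists e, source e = path_target w p.
  move=> pp; apply: contrapT => ne; apply: ns; exists p; split=> // e ep.
  by apply: ne; exists e.
have prefix p q : is_path w p -> is_path w q -> (size p <= size q)%N ->
    exists r, q = p ++ r.
  elim/last_ind: p => [|p e IHp] pp qq pq; first by exists q.
  move: pp; rewrite -cats1 => /is_path_cat[pp /= [ep _]].
  rewrite size_rcons in pq; have [[|f r] qE] := IHp pp qq (ltnW pq).
    by rewrite qE cats0 ltnn in pq.
  move: qq; rewrite qE => /is_path_cat[_ [fp _]].
  by exists r; rewrite -catA (nbr p e f).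
exists [::]; split=> //; right; split=> [n|p q pp qq pq tpq].
  have [p pp pn] : exists2 p, is_path w p & size p = n.
    elim: n => [|n [p pp pn]]; first by exists [::].
    have [e ep] := ext p pp; exists (p ++ [:: e]); last by rewrite size_cat pn addn1.
    by apply/is_path_cat.
  exists p; split=> // q [qq qn].
  have [|r qE] := prefix p q pp qq; first by rewrite pn qn.
  move: qn; rewrite qE size_cat -pn -[RHS]addn0 => /addnI/size0nil->.
  by rewrite cats0.
have noc p' q' : is_path w p' -> is_path w q' -> (size p' < size q')%N ->
    path_target w p' <> path_target w q'.
  move=> pp' qq' pq' tpq'; have [r qE] := prefix _ _ pp' qq' (ltnW pq').
  move: qq' tpq' pq'; rewrite qE path_target_cat size_cat => /is_path_cat[_ rr] tr.
  rewrite -ltn_subLR // subnn => r0.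
  by apply: (corner_no_cycle rr (esym tr) r0 (N := N.+1)); apply: corner_path.
case/eqP: pq; case: ltngtP => // lpq; first by case: (noc p q).
by case: (noc q p).
Qed.

End Terminal.

(** * Splitting off summands *)

Section RegularModule.
Variables (F : fieldType) (G : digraph).

(** L as a right module over itself; as L may lack an identity, unitality comes from local units. *)
Definition lpa_rmod : Type := lpa F G.
HB.instance Definition _ := GRing.Lmodule.on lpa_rmod.

Fact lpa_rmod_unital (x : lpa_rmod) : exists s : seq (lpa_rmod * lpa F G),
  x = \sum_(p <- s) (p.1 : lpa F G) ** p.2.
Proof.
have [s xE] := lpa_local_unit (x : lpa F G).
exists [seq (x, lpa_vert F w) | w <- undup s].
by rewrite big_map; apply: xE; [apply: undup_uniq | move=> w; rewrite mem_undup].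
Qed.

HB.instance Definition _ := Lmodule_isUnitalRModule.Build F (lpa F G) lpa_rmod
  (fun x a b => esym (numulA (x : lpa F G) a b))
  (@numulDl _ _) (@numulDr _ _) (@numulZl _ _) (@numulZr _ _) lpa_rmod_unital.

End RegularModule.

Section Modules.
Variables (F : fieldType) (G : digraph) (P : urmodType (lpa F G)).
Local Notation L := (lpa F G).
Local Notation V := (@lpa_vert F G).
Implicit Types (x y z : P) (a b c : L) (al : P -> L).

Definition functional al : Prop :=
  linear al /\ forall x a, al (x *> a) = al x ** a.

(** The generators define a surjection from L^n onto P; the coordinates of a splitting are the
    functionals. *)
Lemma projective_dual_basis : rmod_fg P -> rmod_projective P ->
  exists n (x : 'I_n -> P) (al : 'I_n -> P -> L),
    (forall i, functional (al i)) /\ forall y, y = \sum_(i < n) x i *> al i y.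
Proof.
move=> [n [x xgen]] proj; exists n, x.
pose M : urmodType L := rmod_dsum (fun _ : 'I_n => lpa_rmod F G).
pose g (m : M) : P := \sum_(i < n) x i *> (m i : L).
have homg : rmod_hom g.
  split=> [c m m'|m a]; rewrite /g.
    rewrite scaler_sumr -big_split; apply: eq_bigr => i _ /=.
    by rewrite -ractZr -ractDr.
  by rewrite ract_suml; apply: eq_bigr => i _; rewrite ractA.
have surjg y : exists m, g m = y by have [a ->] := xgen y; exists a.
have homid : rmod_hom (@id P) by [].
have [h [[lh ah] hK]] := proj M P g id homg surjg homid.
exists (fun i y => h y i); split=> [i|y]; last by rewrite -{1}(hK y).
by split=> [c y z|y a]; rewrite ?lh ?ah.
Qed.

Fact rank1_subproof y al c : functional al ->
  (fun z => y *> (c ** al z)) \in @rmod_hom_pred F L P.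
Proof.
move=> [la aa]; apply/asboolP; split=> [k u z|u a].
  by rewrite la numulDr numulZr ractDr ractZr.
by rewrite aa numulA ractA.
Qed.

Definition rank1 y al (fal : functional al) c : rmod_end P :=
  RModEnd (rank1_subproof y c fal).

Lemma end_eval_linear al y : functional al ->
  linear (fun f : rmod_end P => al (f y)).
Proof. by move=> [la _] c f g; rewrite -la. Qed.

Lemma functional_comp a al : functional al -> functional (fun z => a ** al z).
Proof.
by move=> [la aa]; split=> [c u z|u b]; rewrite ?la ?aa ?numulDr ?numulZr ?numulA.
Qed.

Lemma functional_hom al (e : P -> P) : rmod_hom e -> functional al ->
  functional (fun z => al (e z)).
Proof.
by move=> [le ae] [la aa]; split=> [c u z|u a]; rewrite ?le ?la ?ae ?aa.
Qed.

Lemma functional_sum al (I : Type) (r : seq I) (Q : pred I) (y : I -> P) :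
  functional al -> al (\sum_(i <- r | Q i) y i) = \sum_(i <- r | Q i) al (y i).
Proof. by case=> la _; exact: (linear_fun_sum r Q y la). Qed.

Definition end_bounded (d : nat) := indep_le (fun _ : rmod_end P => True) d.

(** When moreover [y *> V w = y], the map sending z to [y *> al z] is a projection of P onto a copy
    of wL. *)
Definition splits (w : vertex G) y al : Prop :=
  [/\ functional al, forall x, V w ** al x = al x & al y = V w].

(** The endomorphism [rank1 y fal c] determines c in wLw, by applying it to y and then [al]. *)
Lemma splits_corner d w y al :
  end_bounded d -> splits w y al -> indep_le (@corner F G w) d.
Proof.
move=> dP [fal wal aly].
apply: (indep_le_linear (f := rank1 y fal) (g := fun f : rmod_end P => al (f y))) dP.
- exact: end_eval_linear.
- by [].
- by move=> c cw; rewrite /= fal.2 aly numulA.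
Qed.

(* Lemma [lpa_reduction] applied to a matrix entry of e splits off a corner. *)
Lemma idempotent_summand d (e : P -> P) : rmod_fg P -> rmod_projective P ->
  end_bounded d -> rmod_hom e -> (forall x, e (e x) = e x) ->
  (exists x, e x <> 0) ->
  exists w y al, [/\ terminal w, splits w y al, y *> V w = y, e y = y &
    forall x, al (e x) = al x].
Proof.
move=> Pfg Pproj dP home ee [x ex].
have [n [g [be [fbe beE]]]] := projective_dual_basis Pfg Pproj.
have [i bi] : exists i, be i (e x) <> 0.
  apply: contrapT => nb; apply: ex; rewrite (beE (e x)) big1 // => i _.
  have [->|bi] := pselect (be i (e x) = 0); first by rewrite ract0r.
  by case: nb; exists i.
have [w [r [s [k [c [k0 sc wr sw rsE]]]]]] := lpa_reduction bi.
pose al z := r ** be i (e z).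
have fal : functional al by apply/functional_comp/functional_hom.
pose y0 := e x *> s.
have alE : al y0 = k *: V w + c.
  by rewrite /al /y0 home.2 ee (fbe i).2 numulA rsE.
(* A nonzero c would involve a closed path q, and d + 1 endomorphisms built on powers of q would be
   independent: their values al (f y0) are the b q^j b. *)
have c0 : c = 0.
  apply: contrapT => cn0.
  have [_ [q [qq qw q0 _]] _] := lspan_neq0 (f := id) (fun _ _ _ => erefl) sc cn0.
  have /dP : indep d.+1 (fun j => rank1 y0 fal (path_pow F w q j)).
    apply: (indep_linear (end_eval_linear y0 fal)).
    have := indep_path_pow (n := d.+1) k0 sc qq qw q0; rewrite -alE.
    congr indep; apply/funext => j /=.
    by rewrite fal.2 numulA.
  by rewrite ltnn => /(_ (fun=> I)).
have sp : splits w (k^-1 *: y0) al.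
  split=> // [z|]; first by rewrite /al numulA wr.
  by rewrite linear_fun_scale ?alE ?c0 ?addr0 ?scalerA ?mulVf ?scale1r //; case: fal.
(* The pair is transported along a path p to a sink or leak: y becomes y p, and [al] becomes p^*
   [al]. *)
have [p [pp tp]] := corner_terminal (splits_corner dP sp).
case: sp => _ wal aly.
exists (path_target w p), ((k^-1 *: y0) *> lpa_path F w p),
  (fun z => lpa_spath F w p ** al z); split=> //.
- split=> [|z|]; first exact: functional_comp.
    by rewrite numulA lpa_target_spath.
  by rewrite fal.2 aly numulA lpa_spath_vert // lpa_spathK.
- by rewrite ractA lpa_path_target.
- rewrite home.2; congr (_ *> _).
  rewrite linear_fun_scale; last by case: home.
  by rewrite /y0 home.2 ee.
- by move=> z; rewrite /al ee.
Qed.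

(** Indexing by nat gives systems of all lengths the same type; values from n on are arbitrary. *)
Definition dual_system n (w : nat -> vertex G) (y : nat -> P) (al : nat -> P -> L) :=
  [/\ forall i, (i < n)%N -> terminal (w i),
      forall i, (i < n)%N -> splits (w i) (y i) (al i),
      forall i, (i < n)%N -> y i *> V (w i) = y i &
      forall i j, (i < n)%N -> (j < n)%N -> i <> j -> al i (y j) = 0].

(** The n projections are independent: [al j] at [y j] isolates the j-th coefficient. *)
Lemma dual_system_bounded d n w (y : nat -> P) (al : nat -> P -> L) :
  end_bounded d -> dual_system n w y al -> (n <= d)%N.
Proof.
move=> dP [_ sp yw orth].
(* [rank1] requires a functional at every index, so the arbitrary values beyond n are replaced by
   zero. *)
have fal i : functional (if (i < n)%N then al i else fun=> 0).
  case: ifP => [/sp[]//|_]; split=> [c u z|u a]; last by rewrite numul0l.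
  by rewrite scaler0 addr0.
apply: (dP n (fun i => rank1 (y i) (fal i) (V (w i)))) => // c c0 j jn.
have [aj waj ajj] := sp j jn.
pose ev (f : rmod_end P) := al j (f (y j)).
have lev : linear ev := end_eval_linear (y j) aj.
have evE i : (i < n)%N -> ev (rank1 (y i) (fal i) (V (w i))) =
    al j (y i) ** (V (w i) ** al i (y j)).
  by move=> ni; rewrite /ev /= ni aj.2.
have := congr1 ev c0; rewrite (linear_fun_sum _ _ _ lev) -[in RHS](scale0r 0).
rewrite (linear_fun_scale _ _ lev) scale0r (bigD1 (Ordinal jn)) // big1 => [|i ij].
  rewrite (linear_fun_scale _ _ lev) evE //= addr0 ajj !lpa_vert_idem => /eqP.
  by rewrite scaler_eq0 => /orP[/eqP//|/eqP/lpa_vert_neq0].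
rewrite (linear_fun_scale _ _ lev) evE // orth ?numul0l ?scaler0 // => ji.
by case/eqP: ij; apply: val_inj.
Qed.

(** If the projections do not sum to 1, the complement e is a nonzero idempotent to which
    [idempotent_summand] applies. The new pair is orthogonal to the old ones since it is fixed by e,
    while e kills each [y j] and each [al j] vanishes on the image of e. *)
Lemma dual_system_extend d n w (y : nat -> P) (al : nat -> P -> L) :
  rmod_fg P -> rmod_projective P ->
  end_bounded d -> dual_system n w y al ->
  (forall x, x = \sum_(i < n) y i *> al i x) \/
  exists w (y : nat -> P) (al : nat -> P -> L), dual_system n.+1 w y al.
Proof.
move=> Pfg Pproj dP [tw sp yw orth].
have [//|ncomp] := pselect (forall x, x = \sum_(i < n) y i *> al i x); first by left.
right; pose g x := \sum_(i < n) y i *> al i x.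
have lg : rmod_hom g.
  split=> [c x z|x a]; rewrite /g.
    rewrite scaler_sumr -big_split; apply: eq_bigr => i _ /=.
    by have [[l _] _ _] := sp i (ltn_ord i); rewrite l ractDr ractZr.
  rewrite ract_suml; apply: eq_bigr => i _ /=.
  by have [[_ a_] _ _] := sp i (ltn_ord i); rewrite a_ ractA.
have alg j x : (j < n)%N -> al j (g x) = al j x.
  move=> jn; have [fj wj ajj] := sp j jn.
  rewrite (functional_sum _ _ _ fj) (bigD1 (Ordinal jn)) //= big1 => [|i ij].
    by rewrite addr0 fj.2 ajj wj.
  rewrite fj.2 orth ?numul0l // => ji.
  by case/eqP: ij; apply: val_inj.
have gy j : (j < n)%N -> g (y j) = y j.
  move=> jn; rewrite /g (bigD1 (Ordinal jn)) //= big1 => [|i ij].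
    by rewrite addr0; have [_ _ ->] := sp j jn; apply: yw.
  rewrite orth ?ract0r // => ji.
  by case/eqP: ij; apply: val_inj.
have gg x : g (g x) = g x.
  by rewrite {1 3}/g; apply: eq_bigr => i _; rewrite alg.
pose e x := x - g x.
have gB x z : g (x - z) = g x - g z by rewrite addrC -scaleN1r lg.1 scaleN1r addrC.
have le : rmod_hom e.
  split=> [c x z|x a]; rewrite /e.
    by rewrite lg.1 scalerBr opprD addrACA.
  by rewrite lg.2 ractDl -scaleN1r -[- g x]scaleN1r ractZl.
have ee x : e (e x) = e x by rewrite /e gB gg subrr subr0.
have ex : exists x, e x <> 0.
  apply: contrapT => ne; apply: ncomp => x; apply: contrapT => xg.
  by apply: ne; exists x => /eqP; rewrite subr_eq0 => /eqP.
have [w' [y' [al' [tw' sp' yw' ey' ale']]]] := idempotent_summand Pfg Pproj dP le ee ex.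
have e_y j : (j < n)%N -> e (y j) = 0 by move=> jn; rewrite /e gy // subrr.
have al_e j x : (j < n)%N -> al j (e x) = 0.
  move=> jn; have [[lj _] _ _] := sp j jn.
  by rewrite /e addrC -scaleN1r lj alg // scaleN1r addNr.
have al'0 : al' 0 = 0.
  by case: sp' => -[l' _] _ _; rewrite -(scale0r 0) (linear_fun_scale _ _ l') scale0r.
exists (fun i => if (i < n)%N then w i else w'),
  (fun i => if (i < n)%N then y i else y'),
  (fun i => if (i < n)%N then al i else al').
split=> [i _|i _|i _|i j].
1-3: by case: ifP => // ?; auto.
rewrite !ltnS => iln jln ij.
case: (ltnP i n) => ni; case: (ltnP j n) => nj.
- exact: orth.
- by rewrite -ey' al_e.
- by rewrite -ale' e_y.
- by case: ij; apply/eqP; rewrite eqn_leq (leq_trans iln nj) (leq_trans jln ni).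
Qed.

(** Were no system complete, extension would reach length d + 1, against [dual_system_bounded]. *)
Lemma dual_system_complete d : rmod_fg P -> rmod_projective P -> end_bounded d ->
  exists n (w : 'I_n -> vertex G) (y : 'I_n -> P) (al : 'I_n -> P -> L),
    [/\ forall i, terminal (w i), forall i, splits (w i) (y i) (al i),
        forall i, y i *> V (w i) = y i, forall i j, i <> j -> al i (y j) = 0 &
        forall x, x = \sum_(i < n) y i *> al i x].
Proof.
move=> Pfg Pproj dP.
(* The empty system needs a vertex as default value. Without vertices L = 0, so P = 0 and the empty
   family is complete. *)
have [[v _]|nv] := pselect (exists v : vertex G, True); last first.
  exists 0%N; pose f (T : 'I_0 -> Type) (i : 'I_0) : T i := False_rect (T i) (notF (ltn_ord i)).
  exists (f _), (f _), (f _); split=> [[]|[]|[]|[]|x] //.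
  rewrite big_ord0; have [s ->] := ract_unital x; rewrite big1 // => p _.
  have [t tE] := lpa_local_unit p.2.
  rewrite (tE (undup t)) ?undup_uniq // => [|w]; last by rewrite mem_undup.
  by rewrite big1 ?ract0r // => w; case: nv; exists w.
apply: contrapT => ncomp.
suff [w [y [al sys]]] : exists w (y : nat -> P) (al : nat -> P -> L),
    dual_system d.+1 w y al.
  by have := dual_system_bounded dP sys; rewrite ltnn.
elim: d.+1 => [|n [w [y [al sys]]]].
  by exists (fun=> v), (fun=> 0), (fun _ _ => 0).
have [comp|//] := dual_system_extend Pfg Pproj dP sys.
case: ncomp; case: sys => tw sp yw orth.
exists n, (fun i => w i), (fun i => y i), (fun i => al i); split=> // [i|i|i|i j ij].
- exact: tw.
- exact: sp.
- exact: yw.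
- by apply: orth => // /val_inj.
Qed.

End Modules.

(** * Dual bases and direct sums of vertex modules *)

Section VertexModules.
Variables (F : fieldType) (G : digraph) (P : urmodType (lpa F G)).
Local Notation L := (lpa F G).
Local Notation V := (@lpa_vert F G).
Implicit Types (x y z : P) (a b c : L).

Fact vertex_elt_subproof u a : V u ** a \in @vertex_ideal F G u.
Proof. by apply/asboolP; exists a. Qed.

Definition vertex_elt u a : vertex_mod F u := VertexMod (vertex_elt_subproof u a).

Lemma vertex_mod_vert u (m : vertex_mod F u) : V u ** vertex_mod_val m = vertex_mod_val m.
Proof. by case: m => _ /= /asboolP[a ->]; rewrite numulA lpa_vert_idem. Qed.

Section System.
Variables (n : nat) (w : 'I_n -> vertex G) (y : 'I_n -> P) (al : 'I_n -> P -> L).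

Definition dual_bases : Prop :=
  [/\ forall i, splits (w i) (y i) (al i), forall i, y i *> V (w i) = y i,
      forall i j, i <> j -> al i (y j) = 0 &
      forall x, x = \sum_(i < n) y i *> al i x].

Lemma dual_bases_iso : dual_bases ->
  rmod_iso P (rmod_dsum (fun i => vertex_mod F (w i))).
Proof.
case=> sp yw orth yE.
pose f x : rmod_dsum (fun i => vertex_mod F (w i)) :=
  fun i => vertex_elt (w i) (al i x).
exists f; split.
  split=> [c x z|x a]; apply: functional_extensionality_dep => i; apply: val_inj;
    have [[l fa] _ _] := sp i; rewrite /= ?l ?fa.
    by rewrite numulDr numulZr.
  by rewrite numulA.
exists (fun h : rmod_dsum (fun i => vertex_mod F (w i)) => \sum_(i < n) y i *> vertex_mod_val (h i)).
  move=> x; rewrite [RHS]yE; apply: eq_bigr => i _ /=.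
  by have [_ -> _] := sp i.
move=> h; apply: functional_extensionality_dep => i; apply: val_inj => /=.
have [fi wi yi] := sp i; rewrite wi (functional_sum _ _ _ fi) (bigD1 i) //= big1.
  by rewrite addr0 fi.2 yi vertex_mod_vert.
by move=> j /eqP ij; rewrite fi.2 orth ?numul0l //; apply/nesym.
Qed.

End System.

(** Here y_i is the preimage of the generator w_i of the i-th summand, and al_i is the i-th
    coordinate. *)
Lemma iso_dual_bases n (w : 'I_n -> vertex G) :
  rmod_iso P (rmod_dsum (fun i => vertex_mod F (w i))) ->
  exists (y : 'I_n -> P) (al : 'I_n -> P -> L), dual_bases w y al.
Proof.
case=> f [[lf af] [g fK gK]].
have ag m a : g (m *> a) = g m *> a by apply: (can_inj fK); rewrite af !gK.
pose inj i := @dsum_inj F L n (fun i => vertex_mod F (w i)) i (vertex_elt (w i) (V (w i))).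
have ginj_vert i : g (inj i) *> V (w i) = g (inj i).
  rewrite -ag; congr (g _); change (dsum_act (inj i) (V (w i)) = inj i).
  rewrite /inj -dsum_inj_act; apply: (congr1 (@dsum_inj _ _ _ (fun i => vertex_mod F (w i)) i)).
  by apply: val_inj => /=; rewrite !lpa_vert_idem.
exists (fun i => g (inj i)), (fun i x => vertex_mod_val (f x i)).
split=> [i|i|i j ij|x].
- split=> [|x|]; first by split=> [c x z|x a]; rewrite ?lf ?af.
    exact: vertex_mod_vert.
  by rewrite gK /inj dsum_injE /= lpa_vert_idem.
- exact: ginj_vert.
- by rewrite gK /inj dsum_inj_neq //; apply/eqP/nesym.
apply: (can_inj fK); rewrite (linear_fun_sum _ _ _ lf) [LHS]dsum_decomp.
apply: eq_bigr => i _; rewrite -ag gK.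
change (dsum_inj (f x i) = dsum_act (inj i) (vertex_mod_val (f x i))).
rewrite /inj -dsum_inj_act; apply: (congr1 (@dsum_inj _ _ _ (fun i => vertex_mod F (w i)) i)).
by apply: val_inj => /=; rewrite lpa_vert_idem vertex_mod_vert.
Qed.

End VertexModules.

(** * Endomorphisms as block matrices *)

Section EndMatrices.
Variables (F : fieldType) (G : digraph) (P : urmodType (lpa F G)).
Local Notation L := (lpa F G).
Local Notation V := (@lpa_vert F G).
Implicit Types (x z : P).

(** This allows isomorphic summands to be placed at literally the same vertex. *)
Lemma dual_bases_equiv n (w w' : 'I_n -> vertex G) (y : 'I_n -> P)
    (al : 'I_n -> P -> L) :
  (forall i, vert_equiv F (w i) (w' i)) -> dual_bases w y al ->
  exists (y' : 'I_n -> P) (al' : 'I_n -> P -> L), dual_bases w' y' al'.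
Proof.
move=> /choice[p] /choice[q pq] [sp yw orth yE].
exists (fun i => y i *> p i), (fun i x => q i ** al i x).
split=> [i|i|i j ij|x].
- have [_ _ wq _ [_ qp]] := pq i; have [fi wi yi] := sp i.
  split=> [|x|]; first exact: functional_comp.
    by rewrite numulA wq.
  by rewrite fi.2 yi; have [-> _ _ _ _] := pq i.
- by rewrite ractA; have [_ -> _ _ _] := pq i.
- by have [fi _ _] := sp i; rewrite fi.2 orth // numul0l numul0r.
rewrite {1}[x]yE; apply: eq_bigr => i _.
have [_ _ _ _ [pqi _]] := pq i; have [_ wi _] := sp i.
by rewrite ractA numulA pqi wi.
Qed.

Lemma equiv_representatives n (w : 'I_n -> vertex G) : exists r : 'I_n -> 'I_n,
  (forall i, vert_equiv F (w i) (w (r i))) /\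
  (forall i j, vert_equiv F (w i) (w j) -> r i = r j).
Proof.
pose eqv i j := `[< vert_equiv F (w i) (w j) >].
(* [pick] depends only on the predicate, which is the same for equivalent indices. *)
exists (fun i => odflt i [pick j | eqv i j]); split=> [i|i j ij].
  by case: pickP => [j /asboolP//|_]; apply: vert_equiv_refl.
rewrite (@eq_pick _ (eqv i) (eqv j)) => [|k].
  case: pickP => // /(_ j) /negP[]; apply/asboolP; apply: vert_equiv_refl.
apply/asboolP/asboolP; apply: vert_equiv_trans => //.
exact: vert_equiv_sym.
Qed.

(** The nonempty fibers of r index the matrix blocks; sizes are successors because the blocks of
    [end_matrix_sum] are. *)
Lemma fiber_enumeration n (r : 'I_n -> 'I_n) :
  exists (k : nat) (m : 'I_k -> nat) (io : forall t, 'I_(m t).+1 -> 'I_n),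
    [/\ forall i, exists t a, io t a = i,
        forall t t' a b, r (io t a) = r (io t' b) <-> t = t' &
        forall t, injective (io t)].
Proof.
pose img := [set r i | i in 'I_n].
pose fib (t : 'I_#|img|) := [set i | r i == enum_val t].
have fib_gt0 t : (0 < #|fib t|)%N.
  have /imsetP[i _ ti] := enum_valP t.
  by apply/card_gt0P; exists i; rewrite inE ti.
pose io t (a : 'I_(#|fib t|.-1).+1) : 'I_n := enum_val (cast_ord (prednK (fib_gt0 t)) a).
have rio t a : r (io t a) = enum_val t.
  by have := enum_valP (cast_ord (prednK (fib_gt0 t)) a); rewrite inE => /eqP.
exists #|img|, (fun t => #|fib t|.-1), io; split=> [i|t t' a b|t a b].
- have ri : r i \in img by apply: imset_f.
  pose t := enum_rank_in ri (r i).
  have tE : enum_val t = r i by apply: enum_rankK_in.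
  have it : i \in fib t by rewrite inE tE.
  exists t, (cast_ord (esym (prednK (fib_gt0 t))) (enum_rank_in it i)).
  by rewrite /io cast_ordKV enum_rankK_in.
- rewrite !rio; split=> [|->//]; exact: enum_val_inj.
- by move/enum_val_inj/cast_ord_inj.
Qed.

Lemma rmod_end_eq (f g : rmod_end P) n (w : 'I_n -> vertex G) (y : 'I_n -> P)
    (al : 'I_n -> P -> L) : dual_bases w y al ->
  (forall i j, al i (f (y j)) = al i (g (y j))) -> f = g.
Proof.
move=> [sp yw orth yE] fg; apply: rmod_end_ext => x.
have hE (h : rmod_end P) : h x = \sum_(j < n) h (y j) *> al j x.
  have [lh ah] := rmod_endP h; rewrite {1}[x]yE (linear_fun_sum _ _ _ lh).
  by apply: eq_bigr => j _; rewrite ah.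
rewrite !hE; apply: eq_bigr => j _; congr (_ *> _).
by rewrite [LHS]yE [RHS]yE; apply: eq_bigr => i _; rewrite fg.
Qed.

(** The entry al_i (f y_j) lies in w_i L w_j: a scalar multiple of w_i within a class by
    [terminal_corner], zero across classes by [terminal_hom]. Composition becomes the matrix
    product, which is block diagonal. *)
Lemma dual_bases_matrix_sum n (w : 'I_n -> vertex G) (y : 'I_n -> P)
    (al : 'I_n -> P -> L) (r : 'I_n -> 'I_n) :
  dual_bases w y al -> (forall i, terminal (w i)) ->
  (forall i j, r i = r j -> w i = w j) ->
  (forall i j, r i <> r j -> ~ vert_equiv F (w i) (w j)) ->
  end_matrix_sum P.
Proof.
move=> db tw rw rnw; have [sp yw orth yE] := db.
have fal i : functional (al i) by case: (sp i).
have entry i j (f : rmod_end P) : exists c : F,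
    al i (f (y j)) = c *: V (w i) /\ (r i <> r j -> c = 0).
  have -> : al i (f (y j)) = V (w i) ** al i (f (y j)) ** V (w j).
    have [_ wi _] := sp i; have [_ af] := rmod_endP f.
    by rewrite wi -(fal i).2 -af yw.
  have [rij|rij] := eqVneq (r i) (r j).
    have [c cE] := terminal_corner (al i (f (y j))) (tw i).
    by exists c; rewrite -(rw i j rij).
  exists 0; rewrite scale0r; split=> //.
  by apply: terminal_hom => //; apply: rnw; apply/eqP.
pose k i j f := projT1 (cid (entry i j f)).
have kE i j (f : rmod_end P) : al i (f (y j)) = k i j f *: V (w i).
  by rewrite /k; case: cid => c [].
have k0 i j (f : rmod_end P) : r i <> r j -> k i j f = 0.
  by rewrite /k; case: cid => c [].
have k_unique i j (f : rmod_end P) c : al i (f (y j)) = c *: V (w i) -> k i j f = c.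
  rewrite kE => /eqP; rewrite -subr_eq0 -scalerBl scaler_eq0 subr_eq0.
  by case/orP=> [/eqP//|/eqP/lpa_vert_neq0].
have k_linear i j : linear (k i j : rmod_end P -> F^o).
  move=> c f g; apply: k_unique.
  by rewrite (end_eval_linear (y j) (fal i)) !kE scalerDl scalerA.
have k1 i j : k i j 1 = (i == j)%:R.
  apply: k_unique; case: (eqVneq i j) => [<-|/eqP ij].
    by rewrite scale1r; have [_ _ <-] := sp i.
  by rewrite scale0r -(orth _ _ ij).
have kM i j (f g : rmod_end P) : k i j (f * g) = \sum_(l < n) k i l f * k l j g.
  apply: k_unique; rewrite -[LHS]/(al i (f (g (y j)))) {1}[g (y j)]yE.
  have [lf af] := rmod_endP f.
  rewrite (linear_fun_sum _ _ _ lf) (functional_sum _ _ _ (fal i)) scaler_suml.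
  apply: eq_bigr => l _; rewrite af (fal i).2 !kE numulZl numulZr scalerA.
  have [ril|ril] := eqVneq (r i) (r l).
    by rewrite (rw _ _ ril) lpa_vert_idem.
  by rewrite k0 ?mul0r ?scale0r //; apply/eqP.
have [K [m [io [io_surj io_r io_inj]]]] := fiber_enumeration r.
pose phi (f : rmod_end P) (t : 'I_K) : 'M[F]_((m t).+1) :=
  \matrix_(a, b) k (io t a) (io t b) f.
have phi_inj : injective phi.
  move=> f g fg; apply: (rmod_end_eq db) => i j; rewrite !kE; congr (_ *: _).
  have [rij|rij] := eqVneq (r i) (r j); last by rewrite !k0 //; apply/eqP.
  have [[t [a ia]] [t' [b jb]]] := (io_surj i, io_surj j).
  have tt' : t = t' by apply/(io_r _ _ a b); rewrite ia jb.
  subst t'; have := congr1 (fun h : forall t, 'M[F]_((m t).+1) => h t a b) fg.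
  by rewrite /phi !mxE ia jb.
have phi_surj (M : forall t, 'M[F]_((m t).+1)) : exists f, phi f = M.
  (* The block diagonal matrix assembled from M; the sum replaces an explicit inverse of [io]. *)
  pose c i j := \sum_(t < K) \sum_a \sum_b
    if (io t a == i) && (io t b == j) then M t a b else 0.
  have cE t a b : c (io t a) (io t b) = M t a b.
    rewrite /c (bigD1 t) //= [X in _ + X]big1 ?addr0 => [|t' tt'].
      rewrite (bigD1 a) //= [X in _ + X]big1 ?addr0 => [|a' aa'].
        rewrite (bigD1 b) //= [X in _ + X]big1 ?addr0 ?eqxx // => b' bb'.
        by rewrite (inj_eq (io_inj t)) (negPf bb') andbF.
      by rewrite big1 // => b' _; rewrite (inj_eq (io_inj t)) (negPf aa').
    rewrite big1 // => a' _; rewrite big1 // => b' _.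
    case: eqP => //= /(congr1 r) /io_r t'E.
    by rewrite t'E eqxx in tt'.
  have c0 i j : r i <> r j -> c i j = 0.
    move=> rij; rewrite /c big1 // => t _; rewrite big1 // => a _.
    rewrite big1 // => b _; case: eqP => //= ai; case: eqP => // bj.
    by case: rij; rewrite -ai -bj; apply/io_r.
  pose f : rmod_end P := \sum_i \sum_j c i j *: rank1 (y i) (fal j) (V (w i)).
  have kf i j : k i j f = c i j.
    apply: k_unique; have lev := end_eval_linear (y j) (fal i).
    have rankE i' j' : al i (rank1 (y i') (fal j') (V (w i')) (y j)) =
        al i (y i') ** (V (w i') ** al j' (y j)) by rewrite -(fal i).2.
    have fE : al i (f (y j)) = \sum_i' \sum_j'
        c i' j' *: (al i (y i') ** (V (w i') ** al j' (y j))).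
      rewrite /f (linear_fun_sum _ _ _ lev); apply: eq_bigr => i' _.
      rewrite (linear_fun_sum _ _ _ lev); apply: eq_bigr => j' _.
      by rewrite (linear_fun_scale _ _ lev) rankE.
    rewrite fE (bigD1 i) //= [X in _ + X]big1 ?addr0 => [|i' /eqP ii']; last first.
      by rewrite big1 // => j' _; rewrite orth ?numul0l ?scaler0 //; apply/nesym.
    rewrite (bigD1 j) //= [X in _ + X]big1 ?addr0 => [|j' /eqP jj']; last first.
      by rewrite (orth j' j) ?numul0r ?scaler0 //.
    have [rij|rij] := eqVneq (r i) (r j); last first.
      by rewrite c0 ?scale0r //; apply/eqP.
    have [_ _ ->] := sp i; have [_ _ ->] := sp j.
    by rewrite -(rw _ _ rij) !lpa_vert_idem.
  exists f; apply: functional_extensionality_dep => t; apply/matrixP => a b.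
  by rewrite mxE kf.
exists K, m, phi; split=> [|t c f g|t].
- have [h hK] := choice phi_surj.
  by exists h => //; apply: (inj_can_sym hK).
- by apply/matrixP=> a b; rewrite !mxE k_linear.
split=> [|f g]; apply/matrixP=> a b; rewrite !mxE.
  by rewrite k1 (inj_eq (io_inj t)).
(* Only indices l in the class of t contribute; they are reindexed along [io t]. *)
rewrite kM (bigID (fun l => r l == r (io t a))) /= [X in _ + X]big1 ?addr0.
  rewrite (reindex_onto (io t) (fun l => odflt ord0 [pick a' | io t a' == l])) /=.
    apply: eq_big => [a'|a' _]; last by rewrite !mxE.
    rewrite (iffRL (io_r t t a' a) erefl) eqxx; case: pickP => [a'' /eqP/io_inj->|].
      by rewrite eqxx.
    by move=> /(_ a'); rewrite eqxx.
  move=> l /eqP lr; have [t' [b' lE]] := io_surj l.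
  have t't : t' = t by apply/(io_r _ _ b' a); rewrite lE.
  subst t'; case: pickP => [a' /eqP//|/(_ b')].
  by rewrite lE eqxx.
by move=> l /eqP rl; rewrite k0 ?mul0r //; apply/nesym.
Qed.

Lemma matrix_sum_finite_dimensional : end_matrix_sum P -> end_finite_dimensional P.
Proof.
move=> [K [m [phi [[psi phiK psiK] lphi _]]]].
pose I := {t : 'I_K & ('I_(m t).+1 * 'I_(m t).+1)%type}.
exists #|{: I}|; split.
exists (fun f => \row_j phi f (tag (enum_val j)) (tagged (enum_val j)).1
                             (tagged (enum_val j)).2).
  by move=> c f g; apply/rowP=> j; rewrite !mxE lphi !mxE.
pose mx (v : 'rV[F]_#|{: I}|) (t : 'I_K) : 'M[F]_((m t).+1) :=
  \matrix_(a, b) v 0 (enum_rank (Tagged (fun t => ('I_(m t).+1 * 'I_(m t).+1)%type) (a, b) : I)).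
exists (fun v => psi (mx v)) => [f|v].
  rewrite -[RHS]phiK; congr psi; apply: functional_extensionality_dep => t.
  by apply/matrixP=> a b; rewrite !mxE enum_rankK.
apply/rowP=> j; rewrite !mxE psiK mxE; congr (v 0 _).
by apply: enum_val_inj; rewrite enum_rankK; case: (enum_val j) => t [a b].
Qed.

End EndMatrices.

Theorem theorem28 (F : fieldType) (G : digraph) (P : urmodType (lpa F G))
    (P_fg : rmod_fg P) (P_proj : rmod_projective P) :
  (end_finite_dimensional P <->
    exists (n : nat) (v : 'I_n -> vertex G),
      (forall i : 'I_n, sink (v i) \/ leak (v i)) /\
      rmod_iso P (rmod_dsum (fun i : 'I_n => vertex_mod F (v i))))
  /\
  (end_finite_dimensional P <-> end_matrix_sum P).
Proof.
have fd_dsum : end_finite_dimensional P ->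
    exists (n : nat) (v : 'I_n -> vertex G), (forall i, terminal (v i)) /\
      rmod_iso P (rmod_dsum (fun i : 'I_n => vertex_mod F (v i))).
  move=> [d [/vector_axiom_indep_le dP]].
  have [n [w [y [al [tw sp yw orth yE]]]]] := dual_system_complete P_fg P_proj dP.
  by exists n, w; split=> //; apply: (@dual_bases_iso _ _ _ _ w y al).
have dsum_mx (n : nat) (v : 'I_n -> vertex G) : (forall i, terminal (v i)) ->
    rmod_iso P (rmod_dsum (fun i : 'I_n => vertex_mod F (v i))) -> end_matrix_sum P.
  move=> tv /iso_dual_bases[y [al db]].
  (* Each vertex is replaced by the representative of its class, so that equivalent summands share
     one vertex. *)
  have [r [vr rE]] := equiv_representatives F v.
  have [y' [al' db']] := dual_bases_equiv vr db.
  apply: (dual_bases_matrix_sum (r := r) db') => // [i j -> //|i j rij vij].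
  apply: rij; apply: rE; apply: vert_equiv_trans (vr i) _.
  exact: vert_equiv_trans vij (vert_equiv_sym (vr j)).
have mx_fd := @matrix_sum_finite_dimensional F G P.
split; split=> //.
- by move=> [n [v [tv iso]]]; apply/mx_fd/(dsum_mx n v).
- by move=> /fd_dsum[n [v [tv iso]]]; apply: (dsum_mx n v).
Qed.
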